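(* There is an algorithm, computable in $\mathbf S$, which given any code $f$ of a Suslin set $P[f]\subseteq C$ (a $\Sigma_\alpha$- or $\Pi_\alpha$-code) produces Borel codes for Borel sets $B[f]$ and $C[f]$ with $B[f]\subseteq P[f]\subseteq C[f]$ and $\mathbf m(B[f])=\mathbf m(C[f])$.
   Context: $C=\{0,1\}^{\mathbb N}$, $\mathbf m$ the completed uniform product measure. The Suslin functional: $\mathbf S(g)=0$ if $\forall f\in\mathbb N^{\mathbb N}\exists n\,g(\bar f(n))=0$, and $1$ if $\exists f\forall n\,g(\bar f(n))>0$, $\bar f(n)=\langle f(0),\dots,f(n-1)\rangle$; computability is Kleene computability (S1–S9). Suslin sets: a Suslin scheme is $s\mapsto P_s$ on the set $\mathrm{SEQ}$ of finite sequences of naturals, $\mathbf A(\mathbf P)=\bigcup_f\bigcap_n P_{\bar f(n)}$; $\Sigma_0$ clopen sets; $\Sigma_\alpha$ ($\alpha>0$) sets $\mathbf A(\mathbf P)$ with each $P_s\in\Pi_\beta$, $\beta<\alpha$; $\Pi_\alpha$ complements; Suslin sets $=\bigcup_{\alpha<\omega_1}\Sigma_\alpha$. A code is a function in $\mathbb N^{\mathbb N}$ coding a well-founded labelled tree (leaves: clopen sets; inner nodes: complement, or $\mathbf A$ applied to the scheme coded by children indexed by $\mathrm{SEQ}$); $P[f]$ is the coded set. Borel codes are the standard codes for Borel sets via well-founded trees (countable unions and complements). *)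

(* Defs.v *)
From HB Require Import structures.
From mathcomp Require Import all_boot all_order all_algebra.
From mathcomp Require Import boolp classical_sets reals constructive_ereal ereal sequences.
From mathcomp Require Import Rstruct.

Set Implicit Arguments.
Unset Strict Implicit.
Unset Printing Implicit Defensive.

Import Order.TTheory GRing.Theory Num.Theory.
Local Open Scope classical_set_scope.

Definition cantor := nat -> bool.

Definition sq (s : seq nat) : nat := CodeSeq.code s.
Definition unsq (n : nat) : seq nat := CodeSeq.decode n.

Definition fbar (f : nat -> nat) (n : nat) : nat := sq (mkseq f n).

Definition cyl (s : seq bool) : set cantor :=
  [set x | forall i, (i < size s)%N -> x i = nth false s i].

Definition bits (c : nat) : seq bool := map (fun b => b != 0%N) (unsq c).

(* clopen set coded by k: the finite union of the cylinders N_{bits c},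
   c ranging over the list coded by k (every clopen set arises this way) *)
Definition clopen_of (k : nat) : set cantor :=
  [set x | exists2 c, c \in unsq k & cyl (bits c) x].

Definition Aop (P : nat -> set cantor) : set cantor :=
  [set x | exists g : nat -> nat, forall n, P (fbar g n) x].

(** * Suslin codes.
   A code f : N^N labels the nodes sigma (finite sequences) of a tree by
   f <sigma>:  0 = not a node;  1 = complement (single child sigma++[0]);
   2 = Suslin operation A (children sigma++[n], n in N, the child sigma++[n]
       coding the set P_s of the scheme for the s with <s> = n);
   k+3 = leaf, the clopen set clopen_of k.
   [SuslinDen f sigma A] : the subtree of f at sigma is well founded and
   codes A.  It is inductive, so well-foundedness is built in; f is a
   code iff [exists A, SuslinDen f [::] A], and then P[f] = A. *)
Inductive SuslinDen (f : nat -> nat) : seq nat -> set cantor -> Prop :=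
| SD_leaf sigma k : f (sq sigma) = k.+3 -> SuslinDen f sigma (clopen_of k)
| SD_compl sigma A : f (sq sigma) = 1%N ->
    SuslinDen f (rcons sigma 0%N) A -> SuslinDen f sigma (~` A)
| SD_A sigma (P : nat -> set cantor) : f (sq sigma) = 2%N ->
    (forall n, SuslinDen f (rcons sigma n) (P n)) ->
    SuslinDen f sigma (Aop P).

(** * Borel codes (well-founded trees; countable unions and complements).
   Labels: 0 = not a node; 1 = complement (child sigma++[0]);
   2 = countable union (children sigma++[n]); k+3 = leaf, basic open
   cylinder N_{bits k}. *)
Inductive BorelDen (g : nat -> nat) : seq nat -> set cantor -> Prop :=
| BD_leaf sigma k : g (sq sigma) = k.+3 -> BorelDen g sigma (cyl (bits k))
| BD_compl sigma B : g (sq sigma) = 1%N ->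
    BorelDen g (rcons sigma 0%N) B -> BorelDen g sigma (~` B)
| BD_union sigma (Bs : nat -> set cantor) : g (sq sigma) = 2%N ->
    (forall n, BorelDen g (rcons sigma n) (Bs n)) ->
    BorelDen g sigma [set x | exists n, Bs n x].

(** * The (completed) uniform product measure m on C, given by its
   outer measure (Caratheodory/Lebesgue construction from the cylinders,
   m(N_s) = 2^-|s|); on Borel sets it is the product measure. *)
Definition cmeasure (A : set cantor) : \bar Rdefinitions.R :=
  ereal_inf [set (\sum_(0 <= n <oo) (((2 : Rdefinitions.R)^-1) ^+ size (s n))%:E)%E
            | s in [set s : nat -> seq bool |
                    A `<=` [set x | exists n, cyl (s n) x]]].

Definition SuslinF (g : nat -> nat) : nat :=
  if `[< exists f : nat -> nat, forall n, (0 < g (fbar f n))%N >] then 1%N else 0%N.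

(** * Kleene computability (S1-S9) relative to a type-2 functional F,
   with finitely many type-1 arguments [al] and type-0 arguments [xs].
   [KComp F e al xs z] : {e}^F(al, xs) converges with value z. *)
Definition swap_at (T : Type) (x0 : T) (i : nat) (s : seq T) : seq T :=
  if (i.+1 < size s)%N then
    take i s ++ nth x0 s i.+1 :: nth x0 s i :: drop i.+2 s
  else s.

Definition zerof : nat -> nat := fun _ => 0%N.

Inductive KComp (F : (nat -> nat) -> nat) :
    nat -> seq (nat -> nat) -> seq nat -> nat -> Prop :=
| K1 al x xs : KComp F (sq [:: 1%N]) al (x :: xs) x.+1
| K2 al xs q : KComp F (sq [:: 2%N; q]) al xs q
| K3 al x xs : KComp F (sq [:: 3%N]) al (x :: xs) x
| K4 e1 e2 al xs y z : KComp F e2 al xs y -> KComp F e1 al (y :: xs) z ->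
    KComp F (sq [:: 4%N; e1; e2]) al xs z
| K5a e1 e2 al xs z : KComp F e1 al xs z ->
    KComp F (sq [:: 5%N; e1; e2]) al (0%N :: xs) z
| K5b e1 e2 al x xs y z : KComp F (sq [:: 5%N; e1; e2]) al (x :: xs) y ->
    KComp F e2 al (y :: x :: xs) z ->
    KComp F (sq [:: 5%N; e1; e2]) al (x.+1 :: xs) z
| K6n e1 i al xs z : KComp F e1 al (swap_at 0%N i xs) z ->
    KComp F (sq [:: 6%N; i; e1]) al xs z
| K6f e1 i al xs z : KComp F e1 (swap_at zerof i al) xs z ->
    KComp F (sq [:: 7%N; i; e1]) al xs z
| K7 a al x xs : KComp F (sq [:: 8%N]) (a :: al) (x :: xs) (a x)
| K8 e1 al xs (g : nat -> nat) : (forall y, KComp F e1 al (y :: xs) (g y)) ->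
    KComp F (sq [:: 9%N; e1]) al xs (F g)
| K9 e1 al xs z : KComp F e1 al xs z ->
    KComp F (sq [:: 10%N]) al (e1 :: xs) z.

(* Main.v *)
(* For every node of a Suslin code and every [j] one computes a clopen set
   that approximates the coded set up to an error of outer measure [2 ^- j].
   At a node for the operation A, let [K^u] be the union, over the sequences
   [s <= u] with the length of [u], of the intersections of the approximations
   of [P_(s|0)], [P_(s|1)], ...  As [K^u] is clopen, its measure is computable,
   and the Suslin functional decides whether the tree of those [u] for which
   the measure of [K^u] is at least [i * 2 ^- J] has a branch.  Take the least
   [i] for which it has none.  The leftmost branch [g] of the tree for [i - 1]
   gives an inner approximation: the compact set of all points having a branch
   below [g] (Koenig's lemma).  The tree for [i] is well founded, and bar
   recursion along it, starting from [K^u] at its leaves [u] and taking the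
   lower limit over the children at the other nodes, gives an outer
   approximation.  Their difference has measure at most [2 ^- J], plus the
   errors made at the children; letting [J] grow, the inner and outer Borel
   sets differ by a null set. *)

Require Import Defs.
From HB Require Import structures.
From mathcomp Require Import all_boot all_order all_algebra.
From mathcomp Require Import boolp classical_sets reals constructive_ereal ereal sequences.
From mathcomp Require Import Rstruct.
From mathcomp Require Import topology normedtype esum measure.
From mathcomp Require Import zify ring lra.
Set Implicit Arguments.
Unset Strict Implicit.
Unset Printing Implicit Defensive.
Import Order.TTheory GRing.Theory Num.Theory.
Local Open Scope classical_set_scope.

(** The obstacle on the computational side is convergence: S8 consults [SuslinF] on total functions
    only, and a recursive call outside the code need not converge. So calls are guarded by tests on
    labels, and the worlds of a context carry the facts under which their calls converge. On the
    analytic side everything is compared with clopen sets: their measure is a quotient of two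
    counted numbers, and rounding it down to a multiple of [2 ^- J] costs only another [2 ^- J]. One
    clopen set serves both Borel sets. The error set joins outer minus clopen and clopen minus
    inner, which is invariant under complementation, so a complement node merely exchanges the two
    sides. The Borel trees are not built by recursion. The label at an address is read off after
    running an automaton along that address; the bar recursion is just the unfolding of states, and
    well-foundedness enters only in the proof that the tree denotes a set. *)

Lemma sq_nil : sq [::] = 0. Proof. by []. Qed.

Lemma sq_cons n s : sq (n :: s) = 2 ^ n * (sq s).*2.+1. Proof. by []. Qed.

Lemma sqK : cancel sq unsq. Proof. exact: CodeSeq.codeK. Qed.

Lemma unsqK : cancel unsq sq. Proof. exact: CodeSeq.decodeK. Qed.

(* Indices are numbers far too large to be computed. *)
Opaque sq.

(** * Programming with Kleene indices *)

(* A context is a type of worlds: [ctx_fun] is the type-1 argument and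
   [ctx_env] the list of type-0 arguments that a world supplies.
   Functions on the worlds are computed uniformly by one index. *)
Record ctx := Ctx {
  world :> Type;
  ctx_fun : world -> nat -> nat;
  ctx_env : world -> seq nat }.

Definition ext (G : ctx) : ctx :=
  @Ctx (G * nat)%type (fun p => ctx_fun p.1) (fun p => p.2 :: ctx_env p.1).

Definition sub_ctx (G : ctx) (D : G -> Prop) : ctx :=
  @Ctx {w : G | D w} (fun w => ctx_fun (sval w)) (fun w => ctx_env (sval w)).

Definition Cmp (G : ctx) (phi : G -> nat) : Prop :=
  exists e, forall w : G,
    KComp SuslinF e [:: ctx_fun w] (ctx_env w) (phi w).

Lemma eq_Cmp (G : ctx) (phi psi : G -> nat) :
  phi =1 psi -> Cmp phi -> Cmp psi.
Proof. by move=> eq_phi [e He]; exists e => w; rewrite -eq_phi. Qed.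

(* S5 whose step returns the previous value computes its base, whatever
   the recursion argument: this discards the first argument. *)
Lemma KComp_drop F e al x xs z :
  KComp F e al xs z -> KComp F (sq [:: 5; e; sq [:: 3]]) al (x :: xs) z.
Proof.
move=> He; elim: x => [|x IHx]; first exact: K5a.
exact: K5b IHx (K3 _ _ _ _).
Qed.

Lemma swap_at_cat xs ys x y :
  swap_at 0 (size xs) (xs ++ x :: y :: ys) = xs ++ y :: x :: ys.
Proof.
rewrite /swap_at size_cat /= addnS ltnS addnS leq_addr take_size_cat //.
rewrite !nth_cat !ltnNge leqnn leqnSn /= subnn subSnn /=; congr (_ ++ [:: _, _ & _]).
by rewrite drop_cat ltnNge -addn2 leq_addr addKn /= drop0.
Qed.

Lemma KComp_swap F e al xs ys x y z :
  KComp F e al (xs ++ y :: x :: ys) z ->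
  KComp F (sq [:: 6; size xs; e]) al (xs ++ x :: y :: ys) z.
Proof. by rewrite -swap_at_cat; apply: K6n. Qed.

Lemma KComp_swap0 F e al xs x y z :
  KComp F e al (y :: x :: xs) z -> KComp F (sq [:: 6; 0; e]) al (x :: y :: xs) z.
Proof. exact: (@KComp_swap F e al [::]). Qed.

Lemma KComp_swap1 F e al xs t x y z :
  KComp F e al [:: t, y, x & xs] z ->
  KComp F (sq [:: 6; 1; e]) al [:: t, x, y & xs] z.
Proof. exact: (@KComp_swap F e al [:: t]). Qed.

Lemma KComp_swap2 F e al xs t u x y z :
  KComp F e al [:: t, u, y, x & xs] z ->
  KComp F (sq [:: 6; 2; e]) al [:: t, u, x, y & xs] z.
Proof. exact: (@KComp_swap F e al [:: t; u]). Qed.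

Section Closure.
Variable G : ctx.
Implicit Types phi psi : G -> nat.

Lemma Cmp_const c : @Cmp G (fun=> c).
Proof. by exists (sq [:: 2; c]) => w; apply: K2. Qed.

Lemma Cmp_var0 : @Cmp (ext G) (fun p => p.2).
Proof. by exists (sq [:: 3]) => p; apply: K3. Qed.

Lemma Cmp_weak phi : Cmp phi -> @Cmp (ext G) (fun p => phi p.1).
Proof. by move=> [e He]; eexists => p; apply: KComp_drop (He _). Qed.

Lemma Cmp_let phi (psi : G -> nat -> nat) :
  @Cmp (ext G) (fun p => psi p.1 p.2) -> Cmp phi ->
  Cmp (fun w => psi w (phi w)).
Proof.
by move=> [e He] [e' He']; eexists => w; apply: K4 (He' w) (He (w, phi w)).
Qed.

Lemma Cmp_succ phi : Cmp phi -> Cmp (fun w => (phi w).+1).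
Proof. by move=> [e He]; eexists => w; apply: K4 (He w) (K1 _ _ _ _). Qed.

Lemma Cmp_fun phi : Cmp phi -> Cmp (fun w => ctx_fun w (phi w)).
Proof. by move=> [e He]; eexists => w; apply: K4 (He w) (K7 _ _ _ _ _). Qed.

Lemma Cmp_iteri phi (step : G -> nat -> nat -> nat) psi :
  Cmp phi -> @Cmp (ext (ext G)) (fun p => step p.1.1 p.1.2 p.2) -> Cmp psi ->
  Cmp (fun w => iteri (phi w) (step w) (psi w)).
Proof.
move=> Hphi [e He] [e' He'].
pose rec w x := iteri x (step w) (psi w).
apply: (Cmp_let (psi := rec)) Hphi.
exists (sq [:: 5; e'; e]) => -[w x] /=; elim: x => [|x IHx]; first exact: K5a.
exact: K5b IHx (He ((w, x), rec w x)).
Qed.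

Lemma Cmp_Suslin (g : G -> nat -> nat) :
  @Cmp (ext G) (fun p => g p.1 p.2) -> Cmp (fun w => SuslinF (g w)).
Proof.
by move=> [e He]; eexists => w; apply: K8 => y; exact: (He (w, y)).
Qed.

Lemma Cmp_sub phi (D : G -> Prop) :
  Cmp phi -> @Cmp (sub_ctx D) (fun w => phi (sval w)).
Proof. by move=> [e He]; exists e => w; apply: He. Qed.

End Closure.

Ltac cmp_var :=
  match goal with
  | |- Cmp (fun p => p.2) => exact: Cmp_var0
  | |- Cmp snd => exact: Cmp_var0
  | |- Cmp (fun p => p.1.2) =>
      exact: (@Cmp_weak (ext _) (fun q => q.2) (Cmp_var0 _))
  | |- Cmp (fun p => p.1.1.2) =>
      exact: (@Cmp_weak (ext (ext _)) (fun q => q.1.2)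
             (@Cmp_weak (ext _) (fun q => q.2) (Cmp_var0 _)))
  | |- Cmp (fun p => p.1.1.1.2) =>
      exact: (@Cmp_weak (ext (ext (ext _))) (fun q => q.1.1.2)
             (@Cmp_weak (ext (ext _)) (fun q => q.1.2)
             (@Cmp_weak (ext _) (fun q => q.2) (Cmp_var0 _))))
  | |- Cmp (fun p => p.1.1.1.1.2) =>
      exact: (@Cmp_weak (ext (ext (ext (ext _)))) (fun q => q.1.1.1.2)
             (@Cmp_weak (ext (ext (ext _))) (fun q => q.1.1.2)
             (@Cmp_weak (ext (ext _)) (fun q => q.1.2)
             (@Cmp_weak (ext _) (fun q => q.2) (Cmp_var0 _)))))
  | |- Cmp (fun p => ?phi p.1) => apply: (@Cmp_weak _ phi)
  | |- Cmp (fun p => ?phi p.1.1) => apply: (@Cmp_weak (ext _) (fun q => phi q.1))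
  | |- Cmp (fun p => ?phi p.1.1.1) => apply: (@Cmp_weak (ext (ext _)) (fun q => phi q.1.1))
  | |- Cmp (fun p => ?phi p.1.1.1.1) =>
      apply: (@Cmp_weak (ext (ext (ext _))) (fun q => phi q.1.1.1))
  end.

(** A hook for the closure rules: it is redefined whenever further operations have been shown
    computable, and [cmp] uses the current version. *)
Ltac cmp_rule := fail.

Ltac cmp :=
  repeat (cbv beta;
    first [ assumption | exact: Cmp_const | cmp_var
          | lazymatch goal with
            | |- Cmp (fun w => S (@?a w)) => apply: Cmp_succ
            | |- Cmp (fun w => iteri (@?a w) (@?b w) (@?c w)) => apply: Cmp_iteri
            | |- Cmp (fun w => ctx_fun w (@?a w)) => apply: Cmp_fun
            end
          | cmp_rule ]).

Lemma Cmp_pred (G : ctx) (phi : G -> nat) :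
  Cmp phi -> Cmp (fun w => (phi w).-1).
Proof.
move=> H; apply: (@eq_Cmp _ (fun w => iteri (phi w) (fun x _ => x) 0)).
  by move=> w; case: (phi w).
cmp.
Qed.

Lemma Cmp_addn (G : ctx) (phi psi : G -> nat) :
  Cmp phi -> Cmp psi -> Cmp (fun w => phi w + psi w).
Proof.
move=> H H'.
apply: (@eq_Cmp _ (fun w => iteri (phi w) (fun _ y => y.+1) (psi w))).
  by move=> w; elim: (phi w) => //= n ->.
cmp.
Qed.

Ltac cmp_rule ::=
  lazymatch goal with
  | |- Cmp (fun w => predn (@?a w)) => apply: Cmp_pred
  | |- Cmp (fun w => addn (@?a w) (@?b w)) => apply: Cmp_addn
  end.

Lemma Cmp_subn (G : ctx) (phi psi : G -> nat) :
  Cmp phi -> Cmp psi -> Cmp (fun w => phi w - psi w).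
Proof.
move=> H H'.
apply: (@eq_Cmp _ (fun w => iteri (psi w) (fun _ y => y.-1) (phi w))).
  by move=> w; elim: (psi w) => [|n /= ->]; [rewrite subn0 | rewrite subnS].
cmp.
Qed.

Lemma Cmp_muln (G : ctx) (phi psi : G -> nat) :
  Cmp phi -> Cmp psi -> Cmp (fun w => phi w * psi w).
Proof.
move=> H H'.
apply: (@eq_Cmp _ (fun w => iteri (phi w) (fun _ y => psi w + y) 0)).
  by move=> w; elim: (phi w) => //= n ->; rewrite mulSn.
cmp.
Qed.

Ltac cmp_rule ::=
  lazymatch goal with
  | |- Cmp (fun w => predn (@?a w)) => apply: Cmp_pred
  | |- Cmp (fun w => addn (@?a w) (@?b w)) => apply: Cmp_addn
  | |- Cmp (fun w => subn (@?a w) (@?b w)) => apply: Cmp_subn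
  | |- Cmp (fun w => muln (@?a w) (@?b w)) => apply: Cmp_muln
  end.

Lemma Cmp_expn (G : ctx) (phi psi : G -> nat) :
  Cmp phi -> Cmp psi -> Cmp (fun w => phi w ^ psi w).
Proof.
move=> H H'.
apply: (@eq_Cmp _ (fun w => iteri (psi w) (fun _ y => phi w * y) 1)).
  by move=> w; elim: (psi w) => //= n ->; rewrite expnS.
cmp.
Qed.

Section Logic.
Variable G : ctx.
Implicit Types phi psi : G -> nat.
Implicit Types a b : G -> bool.

Lemma Cmp_neg a : Cmp (fun w => a w) -> Cmp (fun w => ~~ a w).
Proof.
by move=> H; apply: (@eq_Cmp _ (fun w => 1 - a w)); [move=> w; case: (a w) | cmp].
Qed.

Lemma Cmp_andb a b :
  Cmp (fun w => a w) -> Cmp (fun w => b w) -> Cmp (fun w => a w && b w).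
Proof.
move=> H H'; apply: (@eq_Cmp _ (fun w => a w * b w)); last by cmp.
by move=> w; rewrite mulnb.
Qed.

Lemma Cmp_orb a b :
  Cmp (fun w => a w) -> Cmp (fun w => b w) -> Cmp (fun w => a w || b w).
Proof.
move=> H H'; apply: (@eq_Cmp _ (fun w => 1 - (1 - a w) * (1 - b w))).
  by move=> w; case: (a w); case: (b w).
cmp.
Qed.

Lemma Cmp_leq phi psi :
  Cmp phi -> Cmp psi -> Cmp (fun w => phi w <= psi w).
Proof.
move=> H H'; apply: (@eq_Cmp _ (fun w => 1 - (phi w - psi w))); last by cmp.
by move=> w; rewrite /leq; case: (phi w - psi w).
Qed.

Lemma Cmp_eqn phi psi :
  Cmp phi -> Cmp psi -> Cmp (fun w => phi w == psi w).
Proof.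
move=> H H'; apply: (@eq_Cmp _ (fun w => (phi w <= psi w) && (psi w <= phi w))).
  by move=> w; rewrite eqn_leq.
by apply: Cmp_andb; apply: Cmp_leq.
Qed.

End Logic.

Ltac cmp_rule ::=
  lazymatch goal with
  | |- Cmp (fun w => predn (@?a w)) => apply: Cmp_pred
  | |- Cmp (fun w => addn (@?a w) (@?b w)) => apply: Cmp_addn
  | |- Cmp (fun w => subn (@?a w) (@?b w)) => apply: Cmp_subn
  | |- Cmp (fun w => muln (@?a w) (@?b w)) => apply: Cmp_muln
  | |- Cmp (fun w => expn (@?a w) (@?b w)) => apply: Cmp_expn
  | |- Cmp (fun w => nat_of_bool (~~ (@?a w))) => apply: Cmp_neg
  | |- Cmp (fun w => nat_of_bool ((@?a w) && (@?b w))) => apply: Cmp_andb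
  | |- Cmp (fun w => nat_of_bool ((@?a w) || (@?b w))) => apply: Cmp_orb
  | |- Cmp (fun w => nat_of_bool (leq (@?a w) (@?b w))) => apply: Cmp_leq
  | |- Cmp (fun w => nat_of_bool (@eq_op _ (@?a w) (@?b w))) => apply: Cmp_eqn
  end.

Definition Cmp1 (G : ctx) (b : G -> nat -> nat) : Prop :=
  Cmp (G := ext G) (fun p => b p.1 p.2).

Lemma Cmp1_weak (G : ctx) (b : G -> nat -> nat) :
  Cmp1 b -> Cmp1 (G := ext G) (fun p => b p.1).
Proof.
move=> [e He]; exists (sq [:: 6; 0; sq [:: 5; e; sq [:: 3]]]) => -[[w x] y].
by apply: KComp_swap0; apply: KComp_drop; apply: (He (w, y)).
Qed.

Lemma Cmp1_app (G : ctx) (b : G -> nat -> nat) (phi : G -> nat) :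
  Cmp1 b -> Cmp phi -> Cmp (fun w => b w (phi w)).
Proof. exact: Cmp_let. Qed.

(* The sequence number of a nonempty prefix of [f] exceeds [f 0], so a
   branch avoiding [b] up to every sequence number is a witness. *)
Lemma Cmp_exists (G : ctx) (b : G -> nat -> bool) :
  Cmp1 (fun w k => b w k) ->
  Cmp (fun w => `[< exists k, b w k >]).
Proof.
move=> Hb.
pose below w c := iteri c (fun k acc => acc + b w k) 0.
have belowP w c : reflect (exists2 k, k < c & b w k) (0 < below w c).
  elim: c => [|c IHc] /=; first by right; case.
  rewrite addn_gt0 lt0b; apply: (iffP orP) => [[/IHc[k lt_kc]|]|[k]].
  - by exists k => //; rewrite ltnS ltnW.
  - by exists c.
  rewrite ltnS leq_eqVlt => /orP[/eqP->|lt_kc] bk; [by right | left].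
  by apply/IHc; exists k.
apply: (@eq_Cmp _ (fun w =>
  SuslinF (fun c => (c == 0) || (0 < below w c)))); last first.
  have Hb3 := Cmp1_weak (Cmp1_weak (Cmp1_weak Hb)).
  by rewrite /below; apply: Cmp_Suslin; cmp; apply: (Cmp1_app Hb3); cmp.
move=> w; rewrite /SuslinF; apply/esym; case: asboolP => [[k bk]|nex].
  case: asboolP => // -[]; exists (fun=> k) => -[|n] //.
  rewrite lt0b; apply/orP; right; apply/belowP; exists k => //.
  rewrite /fbar sq_cons; apply: leq_trans (ltn_expl k (ltnSn 1)) _.
  by rewrite leq_pmulr.
case: asboolP => // -[f /(_ 1)]; rewrite lt0b => /orP[].
  by rewrite /fbar sq_cons sq_nil muln1 expn_eq0.
by case/belowP => k _ bk; case: nex; exists k.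
Qed.

Lemma Cmp_forall (G : ctx) (b : G -> nat -> bool) :
  Cmp1 (fun w k => b w k) ->
  Cmp (fun w => `[< forall k, b w k >]).
Proof.
move=> Hb; apply: (@eq_Cmp _ (fun w => ~~ `[< exists k, ~~ b w k >])).
  move=> w; case: asboolP => [[k /negP nb]|nex].
    by case: asboolP => // /(_ k).
  case: asboolP => // -[] k; apply/negPn/negP => nb; apply: nex.
  by exists k.
by apply: Cmp_neg; apply: Cmp_exists; apply: Cmp_neg.
Qed.

Definition kcons (n m : nat) : nat := 2 ^ n * (m + m).+1.

Lemma kconsE n s : kcons n (sq s) = sq (n :: s).
Proof. by rewrite /kcons addnn sq_cons. Qed.

Lemma Cmp_kcons (G : ctx) (phi psi : G -> nat) :
  Cmp phi -> Cmp psi -> Cmp (fun w => kcons (phi w) (psi w)).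
Proof. by move=> *; rewrite /kcons; cmp. Qed.

(* For an index [y] of a function of one more argument, the index
   [sq [:: 4; y; sq [:: 2; y]]] substitutes [y] for its first argument. *)
Lemma KComp_rec e0 : exists r, forall f xs z,
  KComp SuslinF e0 [:: f] (r :: xs) z -> KComp SuslinF r [:: f] xs z.
Proof.
pose G := @Ctx ((nat -> nat) * nat * seq nat) (fun w => w.1.1)
  (fun w => w.1.2 :: w.2).
have var : Cmp (fun w : G => w.1.2) by exists (sq [:: 3]) => w; apply: K3.
have [ed Hed] : Cmp (fun w : G => kcons 4 (kcons w.1.2
    (kcons (kcons 2 (kcons w.1.2 0)) 0))).
  by do !(assumption || exact: Cmp_const || apply: Cmp_kcons).
pose d := sq [:: 4; sq [:: 6; 0; sq [:: 5; e0; sq [:: 3]]]; ed].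
exists (sq [:: 4; d; sq [:: 2; d]]) => f xs z Hz.
apply: K4 (K2 _ _ _ d) _.
have := Hed (f, d, xs); rewrite /= -sq_nil !kconsE => {}Hed.
by apply: K4 Hed _; apply: KComp_swap0; apply: KComp_drop.
Qed.

(** The selected index is first computed as a number and then run by S9, so only the chosen branch
    has to converge. *)
Lemma KComp_cond eb e1 e2 : exists e, forall f xs (b : bool) z,
  KComp SuslinF eb [:: f] xs b ->
  KComp SuslinF (if b then e1 else e2) [:: f] xs z ->
  KComp SuslinF e [:: f] xs z.
Proof.
pose G := @Ctx ((nat -> nat) * nat * seq nat) (fun w => w.1.1)
  (fun w => w.1.2 :: w.2).
have var : Cmp (fun w : G => w.1.2) by exists (sq [:: 3]) => w; apply: K3.
have [es Hes] : Cmp (fun w : G => iteri w.1.2 (fun _ _ => e1) e2) by cmp.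
eexists => f xs b z Hb Hz.
apply: K4 (K4 Hb (Hes (f, nat_of_bool b, xs))) _.
by apply: K9; case: b Hz {Hb}.
Qed.

(** Each branch is computed only on the worlds that satisfy its guard; elsewhere its index may
    diverge. *)
Lemma Cmp_cond (G : ctx) (b : G -> bool) (phi : G -> nat) :
  Cmp (fun w => b w) ->
  Cmp (G := sub_ctx (fun w => b w)) (fun w => phi (sval w)) ->
  Cmp (G := sub_ctx (fun w => ~~ b w)) (fun w => phi (sval w)) ->
  Cmp phi.
Proof.
move=> [eb Hb] [e1 H1] [e2 H2]; have [e He] := KComp_cond eb e1 e2.
exists e => w; apply: He (Hb w) _; case: (boolP (b w)) => bw.
  exact: (H1 (exist _ w bw)).
exact: (H2 (exist _ w bw)).
Qed.

Lemma Cmp_if (G : ctx) (b : G -> bool) (phi psi : G -> nat) :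
  Cmp (fun w => b w) -> Cmp phi -> Cmp psi ->
  Cmp (fun w => if b w then phi w else psi w).
Proof.
move=> Hb Hphi Hpsi; apply: (Cmp_cond Hb).
  by move: (@Cmp_sub _ phi (fun w => b w) Hphi); apply: eq_Cmp => -[w /= ->].
move: (@Cmp_sub _ psi (fun w => ~~ b w) Hpsi).
by apply: eq_Cmp => -[w /= /negbTE->].
Qed.

(* [0] when no number satisfies [p]. *)
Definition least (p : nat -> bool) : nat :=
  if pselect (exists n, p n) is left ex then ex_minn ex else 0.

Lemma leastP (p : nat -> bool) n :
  p n -> p (least p) /\ forall k, k < least p -> ~~ p k.
Proof.
move=> pn; rewrite /least; case: pselect => [ex|[]]; last by exists n.
case: ex_minnP => m pm min; split=> // k lt_km; apply/negP => /min.
by rewrite leqNgt lt_km.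
Qed.

Lemma leastE (p : nat -> bool) n :
  p n -> (forall k, p k -> k = n) -> least p = n.
Proof. by move=> pn uniq; have [/uniq] := leastP pn. Qed.

(** [SuslinF] decides beforehand whether a witness exists. If none does, [q] already holds at [0],
    so the search always stops and returns the default value. *)
Lemma Cmp_least (G : ctx) (p : G -> nat -> bool) :
  Cmp1 (fun w k => p w k) -> Cmp (fun w => least (p w)).
Proof.
move=> Hp.
pose q w k := p w k || ~~ `[< exists n, p w n >].
have Hq : Cmp1 (G := G) (fun w k => q w k).
  rewrite /Cmp1 /q; apply: Cmp_orb; first exact: Hp.
  by apply: Cmp_neg; apply: (Cmp_weak (Cmp_exists Hp)).
have eq_least w : q w (least (p w)) /\ forall k, k < least (p w) -> ~~ q w k.
  rewrite /q; case: asboolP => [[n /leastP[pl min]]|nex].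
    rewrite pl; split=> // k /min nk; by rewrite orbF.
  by rewrite orbT /least; case: pselect.
pose H := ext (ext G).
have [i1 Hi1] : Cmp (fun w : H => w.1.2) by cmp.
have [eS HS] : Cmp (fun w : H => w.1.2.+1) by cmp.
pose swap i e := sq [:: 6; i; e].
(* The call at [k + 1]. The arguments are [r, k]; once [k + 1] is put in front, the three swaps give
   [k, r, k + 1], then [k] is dropped and S9 runs [r]. *)
pose i2 := sq [:: 4; swap 1 (swap 0 (swap 1 (sq [:: 5; sq [:: 10]; sq [:: 3]]))); eS].
have [eb Heb] : Cmp (fun w : H => q w.1.1 w.1.2).
  apply: (@Cmp1_app H (fun w k => q w.1.1 k) (fun w => w.1.2)); last by cmp.
  exact: Cmp1_weak (Cmp1_weak Hq).
have [e0 He0] := KComp_cond eb i1 i2; have [r Hr] := KComp_rec e0.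
suff loop w d k : k + d = least (p w) ->
    KComp SuslinF r [:: ctx_fun w] (k :: ctx_env w) (least (p w)).
  by eexists => w; apply: K4 (K2 _ _ _ 0) (loop w (least (p w)) 0 erefl).
have [ql min] := eq_least w.
elim: d k => [|d IHd] k Dl; apply: Hr; apply: He0 (Heb (w, k, r)) _ => /=.
  by rewrite addn0 in Dl; rewrite Dl ql; have := Hi1 (w, k, r); rewrite /= Dl.
rewrite (negbTE (min _ _)); last by rewrite -Dl addnS ltnS leq_addr.
apply: K4 (HS (w, k, r)) _; apply: KComp_swap1; apply: KComp_swap0.
apply: KComp_swap1; apply: KComp_drop; apply: K9.
by apply: IHd; rewrite addSnnS.
Qed.

Lemma Cmp_divn (G : ctx) (phi psi : G -> nat) :
  Cmp phi -> Cmp psi -> Cmp (fun w => phi w %/ psi w).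
Proof.
move=> H H'; apply: (@eq_Cmp _ (fun w =>
  least (fun q => (psi w == 0) || (phi w < q.+1 * psi w)))); last first.
  by apply: Cmp_least; rewrite /Cmp1; cmp.
move=> w; set p := fun q => _; have p_div : p (phi w %/ psi w).
  by rewrite /p; case: posnP => //= d_gt0; rewrite -ltn_divLR.
have [pl min] := leastP p_div; apply/eqP; rewrite eqn_leq.
apply/andP; split; first by rewrite leqNgt; apply/negP => /min; rewrite p_div.
by move: pl; rewrite /p; case: posnP => [->|d_gt0]; rewrite ?divn0 //= -ltn_divLR.
Qed.

Lemma Cmp_modn (G : ctx) (phi psi : G -> nat) :
  Cmp phi -> Cmp psi -> Cmp (fun w => phi w %% psi w).
Proof.
move=> H H'; apply: (@eq_Cmp _ (fun w => phi w - phi w %/ psi w * psi w)).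
  by move=> w; rewrite {1}(divn_eq (phi w) (psi w)) addKn.
by apply: Cmp_subn => //; apply: Cmp_muln => //; apply: Cmp_divn.
Qed.

(** * Operations on sequence numbers *)

Section Lists.
Variable G : ctx.
Implicit Types phi psi : G -> nat.

Lemma Cmp_sq_cons phi (L : G -> seq nat) :
  Cmp phi -> Cmp (fun w => sq (L w)) -> Cmp (fun w => sq (phi w :: L w)).
Proof.
move=> H HL; apply: (eq_Cmp (phi := fun w => kcons (phi w) (sq (L w)))).
  by move=> w; rewrite kconsE.
exact: Cmp_kcons.
Qed.

Lemma Cmp_behead phi : Cmp phi -> Cmp (fun w => sq (behead (unsq (phi w)))).
Proof.
move=> H; apply: (@eq_Cmp _ (fun w => least (fun t =>
  (phi w == 0) || `[< exists n, phi w == kcons n t >]))); last first.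
  apply: Cmp_least; rewrite /Cmp1; cmp; apply: Cmp_exists.
  by rewrite /Cmp1 /kcons; cmp.
move=> w; rewrite -[phi w]unsqK sqK; case: (unsq (phi w)) => [|n s] /=.
  set p := fun t => _; have [_] := @leastP p 0 isT.
  by case: (least p) => // k /(_ 0 isT).
apply: leastE => [|k].
  by apply/orP; right; apply/asboolP; exists n; rewrite kconsE.
rewrite -kconsE muln_eq0 expn_eq0 /= => /asboolP[m].
by rewrite kconsE -[k]unsqK kconsE => /eqP/(can_inj sqK)[_ ->].
Qed.

Lemma Cmp_head phi : Cmp phi -> Cmp (fun w => head 0 (unsq (phi w))).
Proof.
move=> H; apply: (@eq_Cmp _ (fun w => least (fun n =>
  (phi w == 0) || `[< exists t, phi w == kcons n t >]))); last first.
  apply: Cmp_least; rewrite /Cmp1; cmp; apply: Cmp_exists.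
  by rewrite /Cmp1 /kcons; cmp.
move=> w; rewrite -[phi w]unsqK sqK; case: (unsq (phi w)) => [|n s] /=.
  set p := fun t => _; have [_] := @leastP p 0 isT.
  by case: (least p) => // k /(_ 0 isT).
apply: leastE => [|k].
  by apply/orP; right; apply/asboolP; exists (sq s); rewrite kconsE.
rewrite -kconsE muln_eq0 expn_eq0 /= => /asboolP[m].
by rewrite kconsE -[m]unsqK kconsE => /eqP/(can_inj sqK)[].
Qed.

Lemma drop_iteri c i :
  iteri i (fun _ d => sq (behead (unsq d))) c = sq (drop i (unsq c)).
Proof.
elim: i => [|i /= ->]; first by rewrite drop0 unsqK.
by rewrite sqK -drop1 drop_drop.
Qed.

End Lists.

Lemma Cmp_drop (G : ctx) (phi psi : G -> nat) :
  Cmp phi -> Cmp psi -> Cmp (fun w => sq (drop (psi w) (unsq (phi w)))).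
Proof.
move=> H H'; apply: eq_Cmp (fun w => drop_iteri (phi w) (psi w)) _.
by apply: Cmp_iteri => //; apply: Cmp_behead; cmp.
Qed.

Lemma Cmp_nth (G : ctx) (phi psi : G -> nat) :
  Cmp phi -> Cmp psi -> Cmp (fun w => nth 0 (unsq (phi w)) (psi w)).
Proof.
move=> H H'; apply: (eq_Cmp (phi := fun w =>
    head 0 (unsq (sq (drop (psi w) (unsq (phi w))))))).
  by move=> w; rewrite sqK -nth0 nth_drop addn0.
by apply: Cmp_head; apply: Cmp_drop.
Qed.

Lemma Cmp_size (G : ctx) (phi : G -> nat) :
  Cmp phi -> Cmp (fun w => size (unsq (phi w))).
Proof.
move=> H; apply: (eq_Cmp (phi := fun w =>
    least (fun i => sq (drop i (unsq (phi w))) == 0))).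
  move=> w; set p := fun i => _.
  have pE i : p i = (size (unsq (phi w)) <= i).
    rewrite /p -subn_eq0 -size_drop; case: (drop i _) => [|n s].
      by rewrite sq_nil.
    by rewrite sq_cons muln_eq0 expn_eq0.
  have [] := @leastP p (size (unsq (phi w))); first by rewrite pE.
  rewrite pE => le_s min; apply/eqP; rewrite eqn_leq le_s andbT leqNgt.
  by apply/negP => /min; rewrite pE leqnn.
by apply: Cmp_least; rewrite /Cmp1; cmp; apply: Cmp_drop; cmp.
Qed.

Ltac cmp_rule ::=
  lazymatch goal with
  | |- Cmp (fun w => predn (@?a w)) => apply: Cmp_pred
  | |- Cmp (fun w => addn (@?a w) (@?b w)) => apply: Cmp_addn
  | |- Cmp (fun w => subn (@?a w) (@?b w)) => apply: Cmp_subn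
  | |- Cmp (fun w => muln (@?a w) (@?b w)) => apply: Cmp_muln
  | |- Cmp (fun w => expn (@?a w) (@?b w)) => apply: Cmp_expn
  | |- Cmp (fun w => divn (@?a w) (@?b w)) => apply: Cmp_divn
  | |- Cmp (fun w => modn (@?a w) (@?b w)) => apply: Cmp_modn
  | |- Cmp (fun w => nat_of_bool (~~ (@?a w))) => apply: Cmp_neg
  | |- Cmp (fun w => nat_of_bool ((@?a w) && (@?b w))) => apply: Cmp_andb
  | |- Cmp (fun w => nat_of_bool ((@?a w) || (@?b w))) => apply: Cmp_orb
  | |- Cmp (fun w => nat_of_bool (leq (@?a w) (@?b w))) => apply: Cmp_leq
  | |- Cmp (fun w => nat_of_bool (@eq_op _ (@?a w) (@?b w))) => apply: Cmp_eqn
  | |- Cmp (fun w => nat_of_bool (asbool (exists k, is_true (@?b w k)))) =>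
      apply: (@Cmp_exists _ b); rewrite /Cmp1
  | |- Cmp (fun w => nat_of_bool (asbool (forall k, is_true (@?b w k)))) =>
      apply: (@Cmp_forall _ b); rewrite /Cmp1
  | |- Cmp (fun w => least (@?a w)) => apply: Cmp_least; rewrite /Cmp1
  | |- Cmp (fun w => SuslinF (@?a w)) => apply: Cmp_Suslin
  | |- Cmp (fun w => size (unsq (@?a w))) => apply: Cmp_size
  | |- Cmp (fun w => nth 0 (unsq (@?a w)) (@?b w)) => apply: Cmp_nth
  | |- Cmp (fun w => sq (cons (@?a w) (@?b w))) => apply: Cmp_sq_cons
  | |- Cmp (fun w => nat_of_bool (@?a w)) => fail
  | |- _ => apply: Cmp_if
  end.

(** A list is found by searching for the number with the right length and entries; this reduces list
    operations to arithmetic on indices. *)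
Lemma Cmp_sq (G : ctx) (L : G -> seq nat) :
  Cmp (fun w => size (L w)) -> Cmp1 (fun w i => nth 0 (L w) i) ->
  Cmp (fun w => sq (L w)).
Proof.
move=> Hs Hn; apply: (eq_Cmp (phi := fun w => least (fun d =>
  (size (unsq d) == size (L w)) &&
  `[< forall i, nth 0 (unsq d) i == nth 0 (L w) i >]))).
  move=> w; apply: leastE => [|k /andP[/eqP eq_s /asboolP eq_n]].
    by rewrite sqK eqxx; apply/asboolP => i.
  rewrite -[k]unsqK; congr sq; apply: (eq_from_nth (x0 := 0) eq_s) => i _.
  exact/eqP.
cmp.
- exact: (@Cmp_weak _ (fun w => size (L w))).
- apply: (@Cmp1_app (ext (ext G)) (fun p i => nth 0 (L p.1.1) i) (fun p => p.2)).
    exact: Cmp1_weak (Cmp1_weak Hn).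
  by cmp.
Qed.

Lemma Cmp_rcons (G : ctx) (phi psi : G -> nat) :
  Cmp phi -> Cmp psi -> Cmp (fun w => sq (rcons (unsq (phi w)) (psi w))).
Proof.
move=> H H'; apply: Cmp_sq.
  by apply: (eq_Cmp (phi := fun w => (size (unsq (phi w))).+1));
    [move=> w; rewrite size_rcons | cmp].
rewrite /Cmp1; apply: (eq_Cmp (G := ext G) (phi := fun p =>
  if p.2 < size (unsq (phi p.1)) then nth 0 (unsq (phi p.1)) p.2
  else if p.2 == size (unsq (phi p.1)) then psi p.1 else 0)); last by cmp.
by move=> p; rewrite nth_rcons.
Qed.

Lemma Cmp_cat (G : ctx) (phi psi : G -> nat) :
  Cmp phi -> Cmp psi -> Cmp (fun w => sq (unsq (phi w) ++ unsq (psi w))).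
Proof.
move=> H H'; apply: Cmp_sq.
  by apply: (eq_Cmp (phi := fun w => size (unsq (phi w)) + size (unsq (psi w))));
    [move=> w; rewrite size_cat | cmp].
rewrite /Cmp1; apply: (eq_Cmp (G := ext G) (phi := fun p =>
  if p.2 < size (unsq (phi p.1)) then nth 0 (unsq (phi p.1)) p.2
  else nth 0 (unsq (psi p.1)) (p.2 - size (unsq (phi p.1))))); last by cmp.
by move=> p; rewrite nth_cat.
Qed.

Lemma Cmp_take (G : ctx) (phi psi : G -> nat) :
  Cmp phi -> Cmp psi -> Cmp (fun w => sq (take (psi w) (unsq (phi w)))).
Proof.
move=> H H'; apply: Cmp_sq.
  apply: (eq_Cmp (phi := fun w => if psi w < size (unsq (phi w)) then psi w
    else size (unsq (phi w)))); last by cmp.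
  by move=> w; rewrite size_take.
rewrite /Cmp1; apply: (eq_Cmp (G := ext G) (phi := fun p =>
  if p.2 < psi p.1 then nth 0 (unsq (phi p.1)) p.2 else 0)); last by cmp.
move=> p; case: ltnP => [|le_p]; first by move=> ?; rewrite nth_take.
by rewrite nth_default // size_take; case: ltnP => // /leq_trans; apply.
Qed.

(** The reversed order of the projections is that of the environment, in which the latest extension
    comes first. *)
Definition Cmp3 (G : ctx) (c : G -> nat -> nat -> nat -> nat) : Prop :=
  Cmp (G := ext (ext (ext G))) (fun p => c p.1.1.1 p.2 p.1.2 p.1.1.2).

Lemma Cmp3_weak (G : ctx) c :
  Cmp3 c -> Cmp3 (G := ext G) (fun p => c p.1).
Proof.
move=> [e He]; eexists => -[[[[w z] y] j] n].
apply: KComp_swap2; apply: KComp_swap1; apply: KComp_swap0; apply: KComp_drop.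
exact: (He (((w, y), j), n)).
Qed.

Lemma Cmp3_app (G : ctx) (c : G -> nat -> nat -> nat -> nat) phi psi chi :
  Cmp3 c -> Cmp phi -> Cmp psi -> Cmp chi ->
  Cmp (fun w => c w (phi w) (psi w) (chi w)).
Proof.
move=> Hc Hphi Hpsi Hchi.
apply: (Cmp_let (psi := fun w y => c w (phi w) (psi w) y)) Hchi.
apply: (Cmp_let (G := ext G) (phi := fun p => psi p.1)
  (psi := fun p j => c p.1 (phi p.1) j p.2)); last exact: Cmp_weak.
apply: (Cmp_let (G := ext (ext G)) (phi := fun p => phi p.1.1)
  (psi := fun p n => c p.1.1 n p.2 p.1.2)); first exact: Hc.
cmp.
Qed.

(** * Approximation by clopen sets *)

(* A clopen set is given by [chi : nat -> bool], read on the number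
   [\sum_(i < N) x i * 2 ^ i] formed from the first bits of a point [x]:
   [depends chi N] says that the first [N] bits matter. *)
Definition depends (chi : nat -> bool) (N : nat) : bool :=
  `[< forall y, chi y == chi (y %% 2 ^ N) :> nat >].

Definition depth (chi : nat -> bool) : nat := least (depends chi).

Definition count_below (chi : nat -> bool) (n : nat) : nat :=
  iteri n (fun y acc => acc + chi y) 0.

(** The measure of the clopen set in units of [2 ^- J], rounded down: an exact integer
    computation. *)
Definition level (J : nat) (chi : nat -> bool) : nat :=
  count_below chi (2 ^ depth chi) * 2 ^ J %/ 2 ^ depth chi.

Definition bounded_by (s u : nat) : bool :=
  (size (unsq s) == size (unsq u)) &&
  `[< forall i, nth 0 (unsq s) i <= nth 0 (unsq u) i >].

Section Node.
(* [c n j y] is the approximation of precision [2 ^- j] to the set coded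
   by the child with number [n]. *)
Variable c : nat -> nat -> nat -> bool.

(** The clopen set [K^u]. The precision [J + t + 1] at the prefix with number [t] makes the errors
    over all [t] sum up to at most [2 ^- J]. *)
Definition comb (J u y : nat) : bool :=
  `[< exists s, bounded_by s u && `[< forall i,
        c (sq (take i (unsq s))) (J + sq (take i (unsq s))).+1 y >] >].

Definition lev (J u : nat) : nat := level J (comb J u).

(* The [i] of the proof idea: the least level whose tree is well founded. *)
Definition cutoff (J : nat) : nat :=
  least (fun i => SuslinF (fun u => i <= lev J u) == 0).

Definition extendible (J u : nat) : bool :=
  SuslinF (fun v => (cutoff J).-1 <= lev J (sq (unsq u ++ unsq v))) == 1.

Definition path_step (J u : nat) : nat :=
  least (fun k => extendible J (sq (rcons (unsq u) k))).

Definition leftmost (J n : nat) : nat :=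
  iteri n (fun _ u => sq (rcons (unsq u) (path_step J u))) 0.

(** Levels along the leftmost branch are naturals, so they attain a minimum. There the clopen set
    exceeds the intersection along the branch by at most [2 ^- J] in measure. *)
Definition stage (J : nat) : nat :=
  least (fun n => `[< forall m, lev J (leftmost J n) <= lev J (leftmost J m) >]).

(* Precision [j + 2], since three errors [2 ^- (j + 2)] have to be added. *)
Definition approx_A (j y : nat) : bool :=
  comb j.+2 (leftmost j.+2 (stage j.+2)) y.

End Node.

Definition leaf_approx (k y : nat) : bool :=
  `[< exists i, (i < size (unsq k)) &&
      `[< forall l, (size (unsq (nth 0 (unsq k) i)) <= l) ||
        ((y %/ 2 ^ l) %% 2 == (nth 0 (unsq (nth 0 (unsq k) i)) l != 0) :> nat) >] >].

(** * Computability of the approximation at a node *)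

Definition Cmpc (G : ctx) (c : G -> nat -> nat -> nat -> bool) :=
  Cmp3 (fun w n j y => c w n j y).

Lemma Cmpc_weak (G : ctx) c : Cmpc c -> Cmpc (G := ext G) (fun p => c p.1).
Proof. exact: Cmp3_weak. Qed.

Ltac cmpc :=
  lazymatch goal with
  | |- Cmpc (fun p => ?c p.1.1) =>
      apply: (@Cmpc_weak (ext _) (fun q => c q.1)); apply: (@Cmpc_weak _ c)
  | |- Cmpc (fun p => ?c p.1) => apply: (@Cmpc_weak _ c)
  | |- _ => idtac
  end; assumption.

Lemma Cmp_depth (G : ctx) (chi : G -> nat -> bool) :
  Cmp1 (fun w y => chi w y) -> Cmp (fun w => depth (chi w)).
Proof.
move=> H; rewrite /depth /depends; cmp.
  apply: (@Cmp1_app (ext (ext G)) (fun p y => chi p.1.1 y) (fun p => p.2)).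
    exact: Cmp1_weak (Cmp1_weak H).
  by cmp.
apply: (@Cmp1_app (ext (ext G)) (fun p y => chi p.1.1 y)
  (fun p => p.2 %% 2 ^ p.1.2)); last by cmp.
exact: Cmp1_weak (Cmp1_weak H).
Qed.

Lemma Cmp_level (G : ctx) (J : G -> nat) (chi : G -> nat -> bool) :
  Cmp J -> Cmp1 (fun w y => chi w y) -> Cmp (fun w => level (J w) (chi w)).
Proof.
move=> HJ H; have Hd := Cmp_depth H; rewrite /level /count_below; cmp.
apply: (@Cmp1_app (ext (ext G)) (fun p y => chi p.1.1 y) (fun p => p.1.2)).
  exact: Cmp1_weak (Cmp1_weak H).
by cmp.
Qed.

Lemma Cmp_comb (G : ctx) c (J u y : G -> nat) :
  Cmpc c -> Cmp J -> Cmp u -> Cmp y ->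
  Cmp (fun w => comb (c w) (J w) (u w) (y w)).
Proof.
move=> Hc HJ Hu Hy; rewrite /comb /bounded_by; cmp.
apply: (@Cmp3_app (ext (ext G)) (fun p n j y => c p.1.1 n j y)
  (fun p => sq (take p.2 (unsq p.1.2)))
  (fun p => (J p.1.1 + sq (take p.2 (unsq p.1.2))).+1) (fun p => y p.1.1)).
- exact: Cmpc_weak (Cmpc_weak Hc).
- by apply: Cmp_take; cmp.
- by cmp; apply: Cmp_take; cmp.
- by cmp.
Qed.

Lemma Cmp_lev (G : ctx) c (J u : G -> nat) :
  Cmpc c -> Cmp J -> Cmp u -> Cmp (fun w => lev (c w) (J w) (u w)).
Proof.
move=> Hc HJ Hu; rewrite /lev; apply: Cmp_level => //.
by rewrite /Cmp1; apply: Cmp_comb; [cmpc | cmp..].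
Qed.

Lemma Cmp_cutoff (G : ctx) c (J : G -> nat) :
  Cmpc c -> Cmp J -> Cmp (fun w => cutoff (c w) (J w)).
Proof.
move=> Hc HJ; rewrite /cutoff; cmp.
by apply: Cmp_lev; [cmpc | cmp..].
Qed.

Lemma Cmp_path_step (G : ctx) c (J u : G -> nat) :
  Cmpc c -> Cmp J -> Cmp u -> Cmp (fun w => path_step (c w) (J w) (u w)).
Proof.
move=> Hc HJ Hu; rewrite /path_step /extendible; cmp.
  by apply: Cmp_cutoff; [cmpc | cmp].
apply: Cmp_lev; [cmpc | by cmp |].
by apply: Cmp_cat; [apply: Cmp_rcons; cmp | cmp].
Qed.

Lemma Cmp_leftmost (G : ctx) c (J n : G -> nat) :
  Cmpc c -> Cmp J -> Cmp n -> Cmp (fun w => leftmost (c w) (J w) (n w)).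
Proof.
move=> Hc HJ Hn; rewrite /leftmost; cmp; apply: Cmp_rcons; cmp.
by apply: Cmp_path_step; [cmpc | cmp..].
Qed.

Lemma Cmp_stage (G : ctx) c (J : G -> nat) :
  Cmpc c -> Cmp J -> Cmp (fun w => stage (c w) (J w)).
Proof.
move=> Hc HJ; rewrite /stage; cmp; (apply: Cmp_lev; [cmpc | by cmp |]);
  (apply: Cmp_leftmost; [cmpc | cmp..]).
Qed.

Lemma Cmp_approx_A (G : ctx) c (j y : G -> nat) :
  Cmpc c -> Cmp j -> Cmp y -> Cmp (fun w => approx_A (c w) (j w) (y w)).
Proof.
move=> Hc Hj Hy; rewrite /approx_A; apply: Cmp_comb => //; cmp.
apply: Cmp_leftmost => //; cmp; apply: Cmp_stage => //; cmp.
Qed.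

Lemma Cmp_leaf_approx (G : ctx) (k y : G -> nat) :
  Cmp k -> Cmp y -> Cmp (fun w => leaf_approx (k w) (y w)).
Proof. by move=> Hk Hy; rewrite /leaf_approx; cmp. Qed.

(** The quantifier over [xs] absorbs the environment of the caller, which stays behind the three
    arguments of the call. *)
Lemma Cmpc_call (G : ctx) (t : G -> nat -> nat) (e : G -> nat)
    (c : G -> nat -> nat -> nat -> bool) :
  Cmp1 t -> Cmp e ->
  (forall w n j y xs,
    KComp SuslinF (e w) [:: ctx_fun w] [:: t w n, j, y & xs] (c w n j y)) ->
  Cmpc c.
Proof.
move=> Ht He Hc.
pose G3 := ext (ext (ext G)).
have [it Hit] : Cmp (fun p : G3 => t p.1.1.1 p.2).
  apply: (@Cmp1_app G3 (fun p n => t p.1.1.1 n) (fun p => p.2)); last by cmp.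
  exact: Cmp1_weak (Cmp1_weak (Cmp1_weak Ht)).
have [ie Hie] : Cmp (fun p : ext G3 => e p.1.1.1.1) by cmp.
eexists => -[[[w y] j] n]; apply: K4 (Hit (((w, y), j), n)) _.
apply: K4 (Hie ((((w, y), j), n), t w n)) _.
apply: KComp_swap1; apply: KComp_swap0; apply: KComp_drop; apply: K9.
exact: Hc.
Qed.

(** The recursion on the code given as a graph: well-foundedness of the tree is a proposition, and
    values are reached by induction on derivations. *)
Inductive Approx (f : nat -> nat) : seq nat -> (nat -> nat -> bool) -> Prop :=
| Approx_leaf sigma k : f (sq sigma) = k.+3 ->
    Approx f sigma (fun=> leaf_approx k)
| Approx_compl sigma a : f (sq sigma) = 1 -> Approx f (rcons sigma 0) a ->
    Approx f sigma (fun j y => ~~ a j y)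
| Approx_A sigma c : f (sq sigma) = 2 ->
    (forall n, Approx f (rcons sigma n) (c n)) ->
    Approx f sigma (approx_A c).

Lemma Approx_inj f sigma a b : Approx f sigma a -> Approx f sigma b -> a = b.
Proof.
move=> Ha; elim: Ha b => {sigma a} [sigma k Dk|sigma a Da _ IHa|sigma c Dc _ IHc] b Hb.
- by case: Hb Dk => [s l ->|s a' ->|s c ->] // [->].
- move: IHa; case: Hb Da => {sigma b} [s l ->|s a' -> Ha' _|s c ->] //.
  by move=> /(_ _ Ha') ->.
- move: IHc; case: Hb Dc => {sigma b} [s l ->|s a' ->|s c' -> Hc' _] //.
  by move=> IHc; congr approx_A; apply: funext => n; apply: IHc.
Qed.

Lemma SuslinDen_Approx f sigma P :
  SuslinDen f sigma P -> exists a, Approx f sigma a.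
Proof.
elim=> {sigma P} [sigma k Dk|sigma A D1 _ [a Ha]|sigma P D2 _ IHP].
- by eexists; apply: Approx_leaf Dk.
- by eexists; apply: Approx_compl Ha.
- by have [c Hc] := choice IHP; eexists; apply: Approx_A Hc.
Qed.

(* The recursive call, whose index is the first argument of the body of
   the recursion, is made at a child [t] of the current node [code]. *)
Record call (T : nat -> nat) := Call {
  call_fun : nat -> nat; call_index : nat; call_code : nat;
  call_prec : nat; call_point : nat; call_rest : seq nat;
  call_val : nat -> nat -> nat -> bool;
  callP : forall n j y xs, KComp SuslinF call_index [:: call_fun]
    [:: sq (rcons (unsq call_code) (T n)), j, y & xs] (call_val n j y) }.

Definition call_ctx (T : nat -> nat) : ctx :=
  @Ctx (call T) (fun w => call_fun w) (fun w => [:: call_index w, call_code w,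
    call_prec w, call_point w & call_rest w]).

(** The recursion theorem hands the index to itself. The induction hypothesis at the children
    becomes the field [callP] of a world, so that the closure lemmas treat the recursive calls as
    given functions. *)
Lemma Cmp_approx : exists e, forall f sigma a, Approx f sigma a ->
  forall j y xs, KComp SuslinF e [:: f] [:: sq sigma, j, y & xs] (a j y).
Proof.
pose H := @Ctx ((nat -> nat) * nat * nat * nat * nat * seq nat)%type
  (fun w => w.1.1.1.1.1)
  (fun w => [:: w.1.1.1.1.2, w.1.1.1.2, w.1.1.2, w.1.2 & w.2]).
have arg0 (G : ctx) (phi : G -> nat) l :
    (forall w, ctx_env w = phi w :: l w) -> Cmp phi.
  by move=> Dw; exists (sq [:: 3]) => w; rewrite Dw; apply: K3.
have arg1 (G : ctx) (phi : G -> nat) x l :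
    (forall w, ctx_env w = [:: x w, phi w & l w]) -> Cmp phi.
  move=> Dw; eexists => w; rewrite Dw; apply: KComp_drop; apply: K3.
have arg2 (G : ctx) (phi : G -> nat) x y l :
    (forall w, ctx_env w = [:: x w, y w, phi w & l w]) -> Cmp phi.
  by move=> Dw; eexists => w; rewrite Dw; do 2!apply: KComp_drop; apply: K3.
have arg3 (G : ctx) (phi : G -> nat) x y z l :
    (forall w, ctx_env w = [:: x w, y w, z w, phi w & l w]) -> Cmp phi.
  by move=> Dw; eexists => w; rewrite Dw; do 3!apply: KComp_drop; apply: K3.
have calls T : Cmp1 (G := call_ctx T) (fun w n => T n) ->
    Cmpc (G := call_ctx T) (fun w => call_val w).
  move=> HT; apply: (@Cmpc_call (call_ctx T) (fun w n =>
      sq (rcons (unsq (call_code w)) (T n)))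
    (fun w => call_index w) (fun w => call_val w)).
  - rewrite /Cmp1; apply: Cmp_rcons; last exact: HT.
    by apply: (@Cmp_weak (call_ctx T) (fun w => call_code w)); apply: arg1.
  - exact: arg0.
  - exact: callP.
have HA : Cmp (G := call_ctx id) (fun w => approx_A (call_val w)
    (call_prec w) (call_point w)).
  apply: Cmp_approx_A; [|exact: arg2|exact: arg3].
  by apply: calls; rewrite /Cmp1; cmp.
have HC : Cmp (G := call_ctx (fun=> 0)) (fun w => ~~ call_val w 0
    (call_prec w) (call_point w)).
  apply: Cmp_neg; apply: (@Cmp3_app (call_ctx (fun=> 0)) (fun w n j y => call_val w n j y)
    (fun=> 0) (fun w => call_prec w) (fun w => call_point w)); [|exact: Cmp_const|exact: arg2|exact: arg3].
  by apply: calls; exact: Cmp_const.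
have [iL HL] : Cmp (fun w : H =>
    leaf_approx (w.1.1.1.1.1 w.1.1.1.2 - 3) w.1.2).
  apply: Cmp_leaf_approx; last exact: arg3.
  cmp; apply: (@Cmp_fun H (fun w => w.1.1.1.2)); exact: arg1.
have lab k : Cmp (fun w : H => w.1.1.1.1.1 w.1.1.1.2 == k).
  cmp; apply: (@Cmp_fun H (fun w => w.1.1.1.2)); exact: arg1.
have [i2 H2] := lab 2; have [i1 H1] := lab 1.
have [iA {}HA] := HA; have [iC {}HC] := HC.
have [e1 He1] := KComp_cond i1 iC iL; have [e2 He2] := KComp_cond i2 iA e1.
have [r Hr] := KComp_rec e2; exists r => f sigma a.
elim=> {sigma a} [sigma k Dk|sigma a D1 _ IHa|sigma c D2 _ IHc] j y xs; apply: Hr.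
all: pose w : H := (f, r, sq sigma, j, y, xs).
- apply: He2 (H2 w) _; rewrite /= Dk; apply: He1 (H1 w) _; rewrite /= Dk.
  by have := HL w; rewrite /= Dk !subSS subn0.
- apply: He2 (H2 w) _; rewrite /= D1; apply: He1 (H1 w) _; rewrite /= D1.
  have IHa' (n : nat) j' y' xs' : KComp SuslinF r [:: f]
      [:: sq (rcons (unsq (sq sigma)) 0), j', y' & xs'] (a j' y').
    by rewrite sqK.
  pose w' := @Call (fun=> 0) f r (sq sigma) j y xs (fun=> a) IHa'.
  exact: (HC w').
- apply: He2 (H2 w) _; rewrite /= D2.
  have IHc' (n : nat) j' y' xs' : KComp SuslinF r [:: f]
      [:: sq (rcons (unsq (sq sigma)) n), j', y' & xs'] (c n j' y').
    by rewrite sqK.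
  pose w' := @Call id f r (sq sigma) j y xs c IHc'.
  exact: (HA w').
Qed.

(** * The outer measure *)

Local Notation R := Rdefinitions.R.

(* The set functional [mu_ext] is only available over a semiring of sets;
   here every set is measurable. *)
Definition discrete_cantor : Type := cantor.

HB.instance Definition _ := Pointed.copy discrete_cantor (nat -> bool).
HB.instance Definition _ := @isMeasurable.Build default_measure_display
  discrete_cantor (fun=> True) I (fun _ _ => I) (fun _ _ => I).

Definition cyl_weight (s : seq bool) : \bar R := ((2^-1 : R) ^+ size s)%:E.

Definition weight (A : set discrete_cantor) : \bar R :=
  ereal_inf [set cyl_weight s | s in [set s | A `<=` cyl s]].

Lemma cyl_weight_ge0 s : (0 <= cyl_weight s)%E.
Proof. by rewrite lee_fin exprn_ge0 // invr_ge0. Qed.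

Lemma weight_ge0 A : (0 <= weight A)%E.
Proof. by apply: le_ereal_inf_tmp => _ [s _ <-]; apply: cyl_weight_ge0. Qed.

Lemma weight_le s (A : set cantor) : A `<=` cyl s -> (weight A <= cyl_weight s)%E.
Proof. by move=> As; apply: ereal_inf_lbound; exists s. Qed.

Lemma weight_fin A : weight A \is a fin_num.
Proof.
rewrite ge0_fin_numE ?weight_ge0 //.
by apply: le_lt_trans (@weight_le [::] A _) _; rewrite ?ltry.
Qed.

Lemma weight0 : weight set0 = 0%E.
Proof.
apply/eqP; rewrite eq_le weight_ge0 andbT; apply/lee_addgt0Pr => e e_gt0.
rewrite add0e.
pose n := Num.bound e^-1%R.
have lt_n : ((2^-1 : R) ^+ n <= e)%R.
  rewrite exprVn -[leRHS]invrK lef_pV2 ?posrE ?invr_gt0 ?exprn_gt0 //.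
  apply: le_trans (ltW (archi_boundP _)) _; first by rewrite invr_ge0 ltW.
  by rewrite -natrX ler_nat ltnW // ltn_expl.
apply: le_trans (@weight_le (nseq n false) _ (@sub0set _ _)) _.
by rewrite lee_fin size_nseq.
Qed.

(** A cover by arbitrary sets is enlarged to one by cylinders, the [k]-th set at a cost of
    [e / 2 ^ k.+1]. This makes the general theory of outer measures available. *)
Lemma cmeasure_ext : cmeasure = (mu_ext weight : set cantor -> \bar R).
Proof.
apply: funext => A; apply/eqP; rewrite eq_le; apply/andP; split; last first.
  apply: le_ereal_inf_tmp => _ [s As <-]; apply: ge_ereal_inf.
  exists (\sum_(k <oo) weight (cyl (s k)))%E.
    exists (fun k => cyl (s k)) => //; split=> // x /As[n xn].
    by exists n.
  by apply: lee_nneseries => [k _ _|k _]; [apply: weight_ge0|apply: weight_le].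
apply: le_ereal_inf_tmp => _ [F [_ AF] <-].
apply/lee_addgt0Pr => e e_gt0.
apply: le_trans (epsilon_trick _ (fun n => weight_ge0 (F n)) (ltW e_gt0)).
have near_weight k : exists s, F k `<=` cyl s /\
    (cyl_weight s <= weight (F k) + (e / (2 ^ k.+1)%:R)%:E)%E.
  have ek : (0 < e / (2 ^ k.+1)%:R)%R by rewrite divr_gt0 // ltr0n expn_gt0.
  have [_ [s Fs <-] lt_s] := lb_ereal_inf_adherent ek (weight_fin (F k)).
  by exists s; split=> //; apply: ltW.
have [s Hs] := choice near_weight; apply: ge_ereal_inf.
exists (\sum_(0 <= n <oo) cyl_weight (s n))%E.
  by exists s => // x /AF[n _ xn]; exists n; apply: (Hs n).1.
apply: lee_nneseries => [k _ _|k _]; first exact: cyl_weight_ge0.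
exact: (Hs k).2.
Qed.

Lemma cmeasure0 : cmeasure set0 = 0%E.
Proof. by rewrite cmeasure_ext mu_ext0 // ?weight0 //; apply: weight_ge0. Qed.

Lemma cmeasure_ge0 A : (0 <= cmeasure A)%E.
Proof. by rewrite cmeasure_ext mu_ext_ge0 //; apply: weight_ge0. Qed.

Lemma le_cmeasure : {homo cmeasure : A B / A `<=` B >-> (A <= B)%E}.
Proof. by rewrite cmeasure_ext => A B; exact: (@le_mu_ext _ discrete_cantor R weight). Qed.

Lemma cmeasure_sigma_subadditive : sigma_subadditive cmeasure.
Proof.
rewrite cmeasure_ext; exact: (@mu_ext_sigma_subadditive _ discrete_cantor R weight weight_ge0).
Qed.

HB.instance Definition _ := isOuterMeasure.Build R cantor cmeasure
  cmeasure0 cmeasure_ge0 le_cmeasure cmeasure_sigma_subadditive.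

Lemma cmeasure_cyl s : (cmeasure (cyl s) <= cyl_weight s)%E.
Proof.
rewrite cmeasure_ext; apply: le_trans (weight_le (@subset_refl _ (cyl s))).
pose F k : set discrete_cantor := if k is 0 then cyl s else set0.
apply: ge_ereal_inf; exists (\sum_(k <oo) weight (F k))%E.
  by exists F => //; split=> // x sx; exists 0%N.
rewrite nneseries_recl //; last by move=> k _; apply: weight_ge0.
by rewrite eseries_cond /= eseries0 ?adde0 // => -[|k] //= _ _; rewrite weight0.
Qed.

(** * Clopen sets, their densities and their measurability *)

Fixpoint prefix_num (x : cantor) (N : nat) : nat :=
  if N is n.+1 then prefix_num x n + x n * 2 ^ n else 0.

Lemma prefix_num_lt x N : prefix_num x N < 2 ^ N.
Proof.
elim: N => //= N IHN; rewrite expnS mul2n -addnn.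
by case: (x N); rewrite ?mul1n ?mul0n; lia.
Qed.

Lemma prefix_num_mod x M N : M <= N -> prefix_num x N %% 2 ^ M = prefix_num x M.
Proof.
elim: N => [|N IHN]; first by rewrite leqn0 => /eqP->; rewrite modn_small.
rewrite leq_eqVlt => /orP[/eqP->|le_M]; first by rewrite modn_small ?prefix_num_lt.
rewrite /= -(subnK (le_M : M <= N)) expnD mulnA addnC modnMDl subnK //.
exact: IHN.
Qed.

Lemma prefix_num_bit x i N : i < N -> (prefix_num x N %/ 2 ^ i) %% 2 = x i.
Proof.
move=> lt_i; rewrite modn_divl -expnS prefix_num_mod //= addnC divnMDl ?expn_gt0 //.
by rewrite divn_small ?prefix_num_lt // addn0.
Qed.

Lemma prefix_num_eq x y N : (prefix_num x N == prefix_num y N) <-> (forall i, i < N -> x i = y i).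
Proof.
split=> [/eqP eq_xy i lt_i|].
  by have := prefix_num_bit x lt_i; rewrite eq_xy prefix_num_bit //; case: (x i); case: (y i).
elim: N => //= N IHN eq_xy; rewrite eq_xy // eqn_add2r.
by apply: IHN => i lt_i; rewrite eq_xy // ltnW.
Qed.

Lemma dependsP chi N :
  reflect (forall y, chi (y %% 2 ^ N) = chi y) (depends chi N).
Proof.
rewrite /depends; apply: (iffP (asboolP _)) => H y; last by rewrite H.
by move: (H y) => /eqP; case: (chi y); case: (chi _).
Qed.

Lemma depends_leq chi M N : depends chi M -> M <= N -> depends chi N.
Proof.
move=> /dependsP H le_MN; apply/dependsP => y.
by rewrite -H modn_dvdm ?dvdn_exp2l // H.
Qed.

Definition clopen_fun (chi : nat -> bool) : Prop := exists N, depends chi N.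

Lemma depends_depth chi : clopen_fun chi -> depends chi (depth chi).
Proof. by case=> N /leastP[]. Qed.

Lemma depth_leq chi N : depends chi N -> depth chi <= N.
Proof.
move=> HN; have [_ min] := leastP HN; rewrite leqNgt.
by apply/negP => /min; rewrite HN.
Qed.

Definition cof (chi : nat -> bool) : set cantor :=
  [set x | chi (prefix_num x (depth chi))].

Lemma cofE chi N x : depends chi N -> cof chi x = chi (prefix_num x N).
Proof.
move=> HN; have /dependsP Hd := depends_depth (ex_intro _ N HN).
by rewrite /cof /= -(prefix_num_mod x (depth_leq HN)) Hd.
Qed.

Lemma count_belowE chi n : count_below chi n = (\sum_(y < n) chi y)%N.
Proof. by elim: n => [|n /= ->]; rewrite ?big_ord0 // big_ord_recr. Qed.

Definition density (chi : nat -> bool) (N : nat) : R :=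
  ((count_below chi (2 ^ N))%:R / 2 ^+ N)%R.

Lemma density_depends chi M N : depends chi M -> M <= N -> density chi N = density chi M.
Proof.
move=> HM; elim: N => [|N IHN]; first by rewrite leqn0 => /eqP->.
rewrite leq_eqVlt => /orP[/eqP->//|le_MN]; rewrite -IHN // /density.
have /dependsP HN := depends_leq HM (le_MN : M <= N).
rewrite !count_belowE expnS mul2n -addnn big_split_ord /=.
rewrite [X in (_ + X)%N](eq_bigr (fun i : 'I_(2 ^ N) => chi i : nat)).
  by rewrite exprS natrD; field; rewrite expf_neq0.
by move=> i _; rewrite -HN modnDl HN.
Qed.

Lemma cmeasure_cof chi N :
  depends chi N -> (cmeasure (cof chi) <= (density chi N)%:E)%E.
Proof.
move=> HN.
pose s y := mkseq (fun i => (y %/ 2 ^ i) %% 2 == 1) N.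
pose F y : set cantor := if chi y then cyl (s y) else set0.
apply: (@le_trans _ _ (cmeasure (\big[setU/set0]_(y < 2 ^ N) F y))).
  apply: le_cmeasure => x; rewrite (cofE _ HN) -bigcup_mkord => chi_x.
  exists (prefix_num x N); rewrite /= ?prefix_num_lt // /F chi_x => i.
  by rewrite size_mkseq => lt_i; rewrite nth_mkseq // prefix_num_bit //; case: (x i).
apply: le_trans (outer_measure_subadditive _ _ _) _.
have le_F (y : 'I_(2 ^ N)) : true ->
    (cmeasure (F y) <= ((chi y)%:R / 2 ^+ N : R)%:E)%E.
  rewrite /F => _; case: (chi y); last by rewrite mul0r cmeasure0.
  by apply: le_trans (cmeasure_cyl _) _; rewrite /cyl_weight size_mkseq mul1r exprVn.
apply: le_trans (lee_sum _ le_F) _.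
by rewrite sumEFin lee_fin -mulr_suml -natr_sum /density count_belowE.
Qed.

Definition cyl_fun (s : seq bool) (y : nat) : bool :=
  y %% 2 ^ size s == prefix_num (nth false s) (size s).

Lemma depends_cyl s : depends (cyl_fun s) (size s).
Proof. by apply/dependsP => y; rewrite /cyl_fun modn_mod. Qed.

Lemma cof_cyl s : cof (cyl_fun s) = cyl s.
Proof.
apply/seteqP; split=> x; rewrite (cofE _ (depends_cyl s)) /cyl_fun prefix_num_mod //;
  by rewrite prefix_num_eq.
Qed.

Lemma density_cyl s : density (cyl_fun s) (size s) = ((2^-1) ^+ size s)%R.
Proof.
rewrite /density count_belowE (bigD1 (Ordinal (prefix_num_lt (nth false s) (size s)))) //=.
rewrite big1 => [|y /negbTE ny].
  by rewrite addn0 /cyl_fun modn_small ?prefix_num_lt // eqxx mul1r exprVn.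
rewrite /cyl_fun modn_small //.
by rewrite -(inj_eq val_inj) /= in ny; rewrite ny.
Qed.

Lemma cof_setI chi1 chi2 N : depends chi1 N -> depends chi2 N ->
  cof (fun y => chi1 y && chi2 y) = cof chi1 `&` cof chi2.
Proof.
move=> H1 H2; have H : depends (fun y => chi1 y && chi2 y) N.
  apply/dependsP => y.
  by move/dependsP: H1 => ->; move/dependsP: H2 => ->.
by apply/seteqP; split=> x /=; rewrite (cofE _ H) (cofE _ H1) (cofE _ H2) => /andP.
Qed.

Lemma depends_neg chi N : depends chi N -> depends (fun y => ~~ chi y) N.
Proof. by move=> /dependsP H; apply/dependsP => y; rewrite H. Qed.

Lemma depends_and chi1 chi2 N : depends chi1 N -> depends chi2 N ->
  depends (fun y => chi1 y && chi2 y) N.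
Proof. by move=> /dependsP H1 /dependsP H2; apply/dependsP => y; rewrite H1 H2. Qed.

Lemma cof_setC chi : clopen_fun chi -> cof (fun y => ~~ chi y) = ~` cof chi.
Proof.
case=> N H; apply/seteqP.
by split=> x /=; rewrite (cofE _ H) (cofE _ (depends_neg H)) => /negP.
Qed.

Lemma density_split chi1 chi2 N : (density (fun y => chi1 y && chi2 y) N +
  density (fun y => chi1 y && ~~ chi2 y) N)%R = density chi1 N.
Proof.
rewrite /density -mulrDl -natrD !count_belowE -big_split /=; congr (_%:R / _)%R; apply: eq_bigr => y _.
by case: (chi1 y); case: (chi2 y).
Qed.

(** At a common depth, each cylinder of a cover splits into its parts inside and outside the clopen
    set, and the two densities add up exactly to the weight of the cylinder. *)
Lemma caratheodory_cof chi :
  clopen_fun chi -> caratheodory_measurable cmeasure (cof chi).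
Proof.
move=> [N HN]; apply: le_caratheodory_measurable => X.
apply: le_ereal_inf_tmp => _ [s Xs <-].
have sub (H : set cantor) : (cmeasure (X `&` H) <=
    \sum_(0 <= n <oo) cmeasure (cyl (s n) `&` H))%E.
  apply: le_trans (cmeasure_sigma_subadditive _).
  by apply: le_cmeasure => x [/Xs[n sx] Hx]; exists n.
apply: le_trans (leeD (sub _) (sub _)) _.
rewrite -nneseriesD; [|by move=> *; exact: cmeasure_ge0..].
apply: lee_nneseries => [n _ _|n _].
  by apply: adde_ge0; apply: cmeasure_ge0.
pose M := maxn (size (s n)) N.
have Ds : depends (cyl_fun (s n)) M by apply: depends_leq (depends_cyl _) (leq_maxl _ _).
have Dc : depends chi M by apply: depends_leq HN (leq_maxr _ _).
rewrite -cof_setC; last by exists N.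
rewrite -cof_cyl -(cof_setI Ds Dc) -(cof_setI Ds (depends_neg Dc)).
apply: le_trans (leeD (cmeasure_cof (depends_and Ds Dc))
  (cmeasure_cof (depends_and Ds (depends_neg Dc)))) _.
rewrite -EFinD density_split (density_depends (depends_cyl _) (leq_maxl _ _)) density_cyl.
by [].
Qed.

(** Continuity from below on the measure space of Caratheodory sets; for this reason measurability
    is carried along for all sets constructed below. *)
Lemma caratheodory_nondecreasing_le (K : realType) (T : pointedType)
    (mu : outer_measure K T) (Y : nat -> set T) q :
  (forall k, caratheodory_measurable mu (Y k)) ->
  (forall k, Y k `<=` Y k.+1) -> (forall k, mu (Y k) <= q)%E ->
  (mu (\bigcup_k Y k) <= q)%E.
Proof.
move=> mY incY leY.
have ndY : nondecreasing_seq Y by apply/nondecreasing_seqP => k; apply/subsetPset.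
have mUY : caratheodory_measurable mu (\bigcup_k Y k).
  exact: caratheodory_measurable_bigcup.
have cvgY := @nondecreasing_cvg_mu _ (caratheodory_type mu) K
  (mu : set (caratheodory_type mu) -> _) Y mY mUY ndY.
rewrite -(cvg_lim _ cvgY) //; apply: lime_le; first by apply/cvg_ex; eexists; exact: cvgY.
by near=> k; apply: leY.
Unshelve. all: by end_near. Qed.

Lemma cmeasureD A B : (cmeasure A <= cmeasure B + cmeasure (A `\` B))%E.
Proof.
apply: le_trans (outer_measureU2 _ _ _); apply: le_cmeasure => x Ax.
by case: (pselect (B x)); [left | right].
Qed.

(** * One application of the Suslin operation *)

Lemma branchP (Q : seq nat -> Prop) :
  Q [::] -> (forall s, Q s -> exists k, Q (rcons s k)) ->
  exists f, forall n, Q (mkseq f n).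
Proof.
move=> Q0 QS.
have /choice[k Hk] s : exists k, Q s -> Q (rcons s k).
  by case: (pselect (Q s)) => [/QS[k]|nQ]; [exists k | exists 0].
pose s n := iteri n (fun _ acc => rcons acc (k acc)) [::].
exists (fun i => k (s i)) => n.
suff -> : mkseq (fun i => k (s i)) n = s n by elim: n => //= n; exact: Hk.
by elim: n => // n IHn; rewrite mkseqS IHn.
Qed.

Lemma boundedP s u : reflect
  (size (unsq s) = size (unsq u) /\
   forall i, nth 0 (unsq s) i <= nth 0 (unsq u) i) (bounded_by s u).
Proof.
by apply: (iffP andP) => -[/eqP ? /asboolP ?].
Qed.

Lemma bounded_rcons s u k l : bounded_by (sq s) (sq u) -> k <= l ->
  bounded_by (sq (rcons s k)) (sq (rcons u l)).
Proof.
move=> /boundedP[]; rewrite !sqK => eq_s le_s le_kl.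
apply/boundedP; rewrite !sqK !size_rcons eq_s; split=> // i.
by rewrite !nth_rcons eq_s; case: ltnP => // _; case: eqP.
Qed.

(** Only finitely many sequences lie below [u], which gives the approximations entering [K^u] a
    common depth. *)
Lemma bounded_max (phi : seq nat -> nat) u : exists N, forall s,
  size s = size u -> (forall i, nth 0 s i <= nth 0 u i) -> phi s <= N.
Proof.
elim: u phi => [|a u IHu] phi; first by exists (phi [::]) => s /size0nil->.
have [N HN] := choice (fun x => IHu (fun s => phi (x :: s))).
exists (\max_(x < a.+1) N x)%N => -[//|x s] [eq_s] le_s.
have lt_x : x < a.+1 by have := le_s 0.
apply: leq_trans (leq_bigmax (Ordinal lt_x)).
by apply: HN => // i; apply: (le_s i.+1).
Qed.

(** Below [g] the tree branches finitely: if every admissible extension of [s] failed at some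
    length, [s] would fail at the largest of these lengths. *)
Lemma konig (S : nat -> Prop) g :
  (forall n, exists s, bounded_by s (fbar g n) /\
     forall i, S (sq (take i (unsq s)))) ->
  exists f, forall n, S (fbar f n).
Proof.
move=> HS.
pose good s m := exists s', [/\ size s' = m, take (size s) s' = s,
  forall i, nth 0 s' i <= g i & forall i, S (sq (take i s'))].
have good_take s m n : size s <= n -> n <= m -> good s m -> good s n.
  move=> le_s le_n [s' [sz ts gs Ss]]; exists (take n s'); split.
  - by rewrite size_takel ?sz.
  - by rewrite take_takel.
  - move=> i; case: (ltnP i n) => [?|le_i]; first by rewrite nth_take.
    by rewrite nth_default // size_take; case: ltnP => // /leq_trans; apply.
  - by move=> i; rewrite -take_min.
have [|s gs|f Hf] := @branchP (fun s => forall m, size s <= m -> good s m).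
- move=> m _; have [s [/boundedP[]]] := HS m.
  rewrite sqK size_mkseq => sz le_s Ss; exists (unsq s); split=> // [|i].
    by rewrite take0.
  case: (ltnP i m) => [lt_i|le_i]; last by rewrite nth_default ?sz.
  by have := le_s i; rewrite nth_mkseq.
- apply: contrapT => nex.
  have bad k : exists m, size s < m /\ ~ good (rcons s k) m.
    apply: contrapT => nm; apply: nex; exists k => m; rewrite size_rcons => lt_m.
    by apply: contrapT => ng; apply: nm; exists m.
  have [M HM] := choice bad.
  (* Beyond all the lengths of failure, and beyond [size s], so that the extension [s'] has an entry
     at position [size s]. *)
  pose m := maxn (size s).+1 (\max_(k < (g (size s)).+1) M k)%N.
  have [s' [sz ts le_s Ss]] := gs m (leq_trans (leqnSn _) (leq_maxl _ _)).
  pose k := nth 0 s' (size s).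
  have lt_k : k < (g (size s)).+1 by rewrite ltnS; apply: le_s.
  have [lt_M] := HM k; apply; apply: (@good_take _ m); rewrite ?size_rcons //.
    by rewrite leq_max; apply/orP; right; exact: (leq_bigmax (Ordinal lt_k)).
  exists s'; split=> //; rewrite size_rcons (take_nth 0) ?ts //.
  by rewrite sz leq_max leqnn.
- exists f => n; have [s' [sz ts _ Ss]] := Hf n _ (leqnn _).
  by move: ts (Ss n); rewrite size_mkseq => ->.
Qed.

Lemma SuslinF_eq1 g : (SuslinF g == 1) = `[< exists f, forall n, 0 < g (fbar f n) >].
Proof. by rewrite /SuslinF; case: asboolP. Qed.

Lemma SuslinF_eq0 g : (SuslinF g == 0) = ~~ `[< exists f, forall n, 0 < g (fbar f n) >].
Proof. by rewrite /SuslinF; case: asboolP. Qed.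

Lemma density_le1 chi N : (density chi N <= 1)%R.
Proof.
rewrite ler_pdivrMr ?exprn_gt0 // mul1r -natrX ler_nat count_belowE.
rewrite -[leqRHS]card_ord -sum1_card; apply: leq_sum => y _.
exact: leq_b1.
Qed.

Lemma level_bounds J chi : let d := density chi (depth chi) in
  ((level J chi)%:R <= d * 2 ^+ J)%R /\ (d * 2 ^+ J < (level J chi).+1%:R)%R.
Proof.
rewrite /= /density /level; set D := depth chi; set n := count_below _ _.
have D_gt0 : 0 < 2 ^ D by rewrite expn_gt0.
rewrite -!natrX mulrAC -natrM; split.
  by rewrite ler_pdivlMr ?ltr0n // -natrM ler_nat leq_trunc_div.
by rewrite ltr_pdivrMr ?ltr0n // -natrM ltr_nat ltn_ceil.
Qed.

Lemma cmeasure_cofD chi1 chi2 : clopen_fun chi1 -> clopen_fun chi2 ->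
  (forall y, chi2 y -> chi1 y) ->
  (cmeasure (cof chi1 `\` cof chi2) <=
    (density chi1 (depth chi1) - density chi2 (depth chi2))%:E)%E.
Proof.
move=> cl1 cl2 sub; pose M := maxn (depth chi1) (depth chi2).
have D1 := depends_leq (depends_depth cl1) (leq_maxl _ _ : _ <= M).
have D2 := depends_leq (depends_depth cl2) (leq_maxr _ _ : _ <= M).
rewrite setDE -cof_setC // -(cof_setI D1 (depends_neg D2)).
apply: le_trans (cmeasure_cof (depends_and D1 (depends_neg D2))) _.
rewrite lee_fin -(density_depends (depends_depth cl1) (leq_maxl _ _ : _ <= M)).
rewrite -(density_depends (depends_depth cl2) (leq_maxr _ _ : _ <= M)) -/M.
rewrite -(density_split chi1 chi2).
rewrite (_ : (fun y => chi1 y && chi2 y) = chi2) ?[(_ + _ - _)%R]addrC ?addKr //.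
by apply: funext => y; rewrite andbC; case: (boolP (chi2 y)) => // /sub.
Qed.

(** With the clopen approximations as [S] this is [K^u]; with the Borel sets of the children it is
    the building block of the inner and outer sets. *)
Definition Fin (S : nat -> set cantor) (u : nat) : set cantor :=
  [set x | exists s, bounded_by s u /\ forall i, S (sq (take i (unsq s))) x].

Local Notation caratheodory := (caratheodory_measurable cmeasure).

Lemma caratheodory_exists (Y : nat -> set cantor) :
  (forall k, caratheodory (Y k)) -> caratheodory [set x | exists k, Y k x].
Proof.
move=> mY; rewrite (_ : [set x | _] = \bigcup_k Y k).
  exact: caratheodory_measurable_bigcup.
by apply/seteqP; split=> x [k]; [move=> xk; exists k | exists k].
Qed.

Lemma caratheodory_forall (Y : nat -> set cantor) :
  (forall k, caratheodory (Y k)) -> caratheodory [set x | forall k, Y k x].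
Proof.
move=> mY; rewrite (_ : [set x | _] = ~` [set x | exists k, (~` Y k) x]).
  apply: caratheodory_measurable_setC; apply: caratheodory_exists => k.
  exact: caratheodory_measurable_setC.
apply/seteqP; split=> x /=; first by move=> Yx [k].
by move=> nY k; apply: contrapT => nYk; apply: nY; exists k.
Qed.

Lemma caratheodory_Fin (S : nat -> set cantor) u :
  (forall t, caratheodory (S t)) -> caratheodory (Fin S u).
Proof.
move=> mS; apply: caratheodory_exists => s.
rewrite (_ : (fun x => _) = if bounded_by s u
    then [set x | forall i, S (sq (take i (unsq s))) x] else set0).
  case: ifP => _; last exact: caratheodory_measurable_set0.
  by apply: caratheodory_forall.
by case: (bounded_by s u); apply/seteqP; split=> x //= [].
Qed.

Lemma bounded_fbar0 f : bounded_by (fbar f (size (unsq 0))) 0.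
Proof.
have u0 : unsq 0 = [::] by rewrite -sq_nil sqK.
by apply/boundedP; rewrite u0 /fbar /=.
Qed.

Section Scheme.
Variable c : nat -> nat -> nat -> bool.
Hypothesis clopen_c : forall t j, clopen_fun (c t j).
Variables B C : nat -> set cantor.
Hypothesis mB : forall t, caratheodory (B t).
Hypothesis mC : forall t, caratheodory (C t).
Hypothesis err_c : forall t j, (cmeasure
  ((C t `\` cof (c t j)) `|` (cof (c t j) `\` B t)) <= ((2^-1 : R) ^+ j)%:E)%E.

Let Q J t := cof (c t (J + t).+1).
Let K J u := cof (comb c J u).
Let Kinf J : set cantor := [set x | forall n, K J (leftmost c J n) x].
Let E J := \bigcup_t ((C t `\` Q J t) `|` (Q J t `\` B t)).

Lemma comb_depends J u : exists N,
  depends (comb c J u) N /\ forall s i, bounded_by s u ->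
    depends (c (sq (take i (unsq s))) (J + sq (take i (unsq s))).+1) N.
Proof.
pose d s := depth (c (sq s) (J + sq s).+1).
pose phi s := (\max_(i < (size s).+1) d (take i s))%N.
have [N HN] := bounded_max phi (unsq u).
have dN s i : bounded_by s u ->
    depends (c (sq (take i (unsq s))) (J + sq (take i (unsq s))).+1) N.
  move=> /boundedP[sz le_s]; apply: depends_leq (depends_depth (clopen_c _ _)) _.
  apply: leq_trans (HN _ sz le_s); rewrite -/(d (take i _)) /phi.
  have lt_i : minn i (size (unsq s)) < (size (unsq s)).+1 by rewrite ltnS geq_minr.
  apply: leq_trans (leq_bigmax (Ordinal lt_i)) => /=.
  by rewrite take_min take_size.
exists N; split=> //; apply/dependsP => y; rewrite /comb; apply: asbool_equiv_eq.
split=> -[s /andP[bs /asboolP cs]]; exists s; rewrite bs; apply/asboolP => i;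
  by move/dependsP: (dN s i bs) (cs i) => ->.
Qed.

Lemma clopen_comb J u : clopen_fun (comb c J u).
Proof. by have [N []] := comb_depends J u; exists N. Qed.

Lemma cof_comb J u : K J u = Fin (Q J) u.
Proof.
have [N [DN dN]] := comb_depends J u; apply/seteqP; split=> x; rewrite /K (cofE _ DN).
  move=> /asboolP[s /andP[bs /asboolP cs]]; exists s; split=> // i.
  by rewrite /Q (cofE _ (dN _ _ bs)).
move=> [s [bs Qs]]; apply/asboolP; exists s; rewrite bs; apply/asboolP => i.
by have := Qs i; rewrite /Q (cofE _ (dN _ _ bs)).
Qed.

Lemma lev_le J u : lev c J u <= 2 ^ J.
Proof.
have [le_d _] := level_bounds J (comb c J u).
rewrite -(ler_nat R) natrX; apply: le_trans le_d _.
by rewrite ler_piMl ?exprn_ge0 // density_le1.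
Qed.

(** Levels never exceed [2 ^ J], so the tree for [2 ^ J + 1] has no branch, while every sequence is
    a branch for [0]. *)
Lemma cutoffP J : [/\ 0 < cutoff c J,
  ~ exists f, forall n, cutoff c J <= lev c J (fbar f n) &
  exists f, forall n, (cutoff c J).-1 <= lev c J (fbar f n)].
Proof.
pose p i := SuslinF (fun u => i <= lev c J u) == 0.
have pP i : reflect (exists f, forall n, i <= lev c J (fbar f n)) (~~ p i).
  rewrite /p SuslinF_eq0 negbK; apply: (iffP (asboolP _)) => -[f Hf];
    by exists f => n; have := Hf n; rewrite lt0b.
have [] := @leastP p (2 ^ J).+1.
  by apply/negPn/pP => -[f /(_ 0)]; rewrite leqNgt ltnS lev_le.
rewrite -/(cutoff c J) => /negPn/pP ncut min.
have cutoff_gt0 : 0 < cutoff c J.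
  by rewrite lt0n; apply/eqP => cut0; apply: ncut; exists id; rewrite cut0.
by split=> //; apply/pP; apply: min; rewrite prednK.
Qed.

Lemma extendibleP J u : reflect
  (exists f, forall n, (cutoff c J).-1 <= lev c J (sq (unsq u ++ mkseq f n)))
  (extendible c J u).
Proof.
rewrite /extendible SuslinF_eq1; apply: (iffP (asboolP _)) => -[f Hf];
  by exists f => n; have := Hf n; rewrite lt0b sqK.
Qed.

Let g J i := path_step c J (leftmost c J i).

Lemma leftmostE J n : leftmost c J n = fbar (g J) n.
Proof.
elim: n => [|n IHn]; first by rewrite /fbar /= sq_nil.
by rewrite /fbar mkseqS -[mkseq _ n]sqK -/(fbar _ _) -IHn.
Qed.

Lemma extendible_leftmost J n : extendible c J (leftmost c J n).
Proof.
elim: n => [|n /extendibleP[f Hf]].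
  have [_ _ [f Hf]] := cutoffP J; apply/extendibleP; exists f => n.
  by rewrite (leftmostE _ 0) sqK; apply: Hf.
rewrite /= -/(leftmost c J n) /path_step.
pose p k := extendible c J (sq (rcons (unsq (leftmost c J n)) k)).
suff pf : p (f 0) by have [] := leastP pf.
apply/extendibleP; exists (fun i => f i.+1) => m.
have := Hf m.+1; rewrite sqK cat_rcons; congr (_ <= lev _ _ (sq (_ ++ _))).
by rewrite /mkseq /= (iotaDl 1 0) -map_comp.
Qed.

Lemma lev_leftmost J n : (cutoff c J).-1 <= lev c J (leftmost c J n).
Proof.
have /extendibleP[f /(_ 0)] := extendible_leftmost J n.
by rewrite cats0 unsqK.
Qed.

Lemma stageP J m : lev c J (leftmost c J (stage c J)) <= lev c J (leftmost c J m).
Proof.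
pose p n := `[< forall m, lev c J (leftmost c J n) <= lev c J (leftmost c J m) >].
suff [n pn] : exists n, p n by have [/asboolP] := leastP pn.
pose q v := `[< exists n, lev c J (leftmost c J n) = v >].
have ex_q : exists v, q v by eexists; apply/asboolP; exists 0.
case: (ex_minnP ex_q) => v /asboolP[n Dv] min; exists n; apply/asboolP => k.
by rewrite Dv; apply: min; apply/asboolP; exists k.
Qed.

(** A witness below the longer leftmost sequence, cut to length [n], is a witness below [u]. *)
Lemma comb_leftmost J u n k y :
  size (unsq u) = n -> bounded_by (leftmost c J n) u ->
  comb c J (leftmost c J (n + k)) y -> comb c J u y.
Proof.
rewrite !leftmostE => sz /boundedP[_]; rewrite sqK => le_u /asboolP[s].
move=> /andP[/boundedP[]]; rewrite !sqK size_mkseq => szs le_s /asboolP cs.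
apply/asboolP; exists (sq (take n (unsq s))); apply/andP; split.
  apply/boundedP; rewrite sqK size_takel ?szs ?leq_addr //; split=> // i.
  case: (ltnP i n) => [lt_i|le_i]; last first.
    by rewrite nth_default // size_takel ?szs ?leq_addr.
  rewrite nth_take //; apply: leq_trans (le_s i) _.
  by have := le_u i; rewrite !nth_mkseq // ltn_addr.
by apply/asboolP => i; rewrite sqK -take_min.
Qed.

(** In units of [2 ^- J], [K^u] measures less than [l] and the sets along the leftmost branch at
    least [l - 1]; continuity from below passes to their intersection. It serves twice: with the
    cutoff as [l] at the leaves of the hull, and with the level plus one at the stage. *)
Lemma cmeasure_branch J u l :
  bounded_by (leftmost c J (size (unsq u))) u -> lev c J u < l ->
  (forall n, l.-1 <= lev c J (leftmost c J n)) ->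
  (cmeasure (K J u `\` Kinf J) <= ((2^-1 : R) ^+ J)%:E)%E.
Proof.
move=> bu lt_l le_l; set n := size _ in bu.
pose Y k := K J u `\` K J (leftmost c J (n + k)).
have subK m k : K J (leftmost c J (m + k)) `<=` K J (leftmost c J m).
  rewrite /K => x; have [M [DM _]] := comb_depends J (leftmost c J (m + k)).
  have [N [DN _]] := comb_depends J (leftmost c J m).
  have D1 := depends_leq DM (leq_maxl M N); have D2 := depends_leq DN (leq_maxr M N).
  rewrite (cofE _ D1) (cofE _ D2); apply: comb_leftmost.
    by rewrite leftmostE sqK size_mkseq.
  by apply/boundedP.
apply: (@le_trans _ _ (cmeasure (\bigcup_k Y k))).
  apply: le_cmeasure => x [Kx nKx]; apply: contrapT => nY; apply: nKx => m.
  apply: contrapT => nKm; apply: nY; exists m; first exact: I.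
  by split; [exact: Kx | rewrite addnC => /subK/nKm].
apply: caratheodory_nondecreasing_le => [k|k|k].
- by apply: caratheodory_measurable_setD; apply: caratheodory_cof; apply: clopen_comb.
- by move=> x [Kx nKx]; split; [exact: Kx | rewrite addnS -addn1 => /subK/nKx].
- apply: le_trans (cmeasure_cofD (clopen_comb _ _) (clopen_comb _ _) _) _.
    by move=> y; apply: comb_leftmost bu.
  rewrite lee_fin; have [_ lt_u] := level_bounds J (comb c J u).
  have [le_k _] := level_bounds J (comb c J (leftmost c J (n + k))).
  have J_gt0 : (0 < (2 : R) ^+ J)%R by rewrite exprn_gt0.
  rewrite exprVn -div1r ler_pdivlMr // mulrBl lerBlDr.
  apply: le_trans (ltW lt_u) _; apply: le_trans (lerD (lexx _) le_k).
  rewrite -[1%R]/(1%:R)%R -natrD ler_nat add1n; apply: leq_trans lt_l _.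
  by apply: leq_trans (leqSpred _) _; rewrite ltnS; apply: le_l.
Qed.

Lemma caratheodory_E J : caratheodory (E J).
Proof.
have mQ t : caratheodory (Q J t) by apply: caratheodory_cof.
apply: caratheodory_measurable_bigcup => t.
by apply: caratheodory_measurable_setU; apply: caratheodory_measurable_setD.
Qed.

Lemma cmeasure_E J : (cmeasure (E J) <= ((2^-1 : R) ^+ J)%:E)%E.
Proof.
apply: le_trans (cmeasure_sigma_subadditive _) _.
have e_ge0 : (0 <= (2^-1 : R) ^+ J)%R by rewrite exprn_ge0 // invr_ge0.
(* Applied to the zero sequence this is just the geometric series of the [e / 2 ^ t.+1]. *)
have := epsilon_trick xpredT (fun _ : nat => lexx (0%E : \bar R)) e_ge0.
rewrite [X in (_ <= X + _)%E -> _]eseries0 // add0e; apply: le_trans; apply: lee_nneseries => [t _ _|t _].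
  exact: cmeasure_ge0.
apply: le_trans (err_c t _) _.
by rewrite add0e lee_fin !exprVn -invfM natrX -exprD addnS.
Qed.

(** Off [E J], membership passes from the outer sets through the clopen ones to the inner sets,
    which transfers clopen estimates to Borel sets. *)
Lemma outsideE J x t : ~ E J x -> (C t x -> Q J t x) /\ (Q J t x -> B t x).
Proof.
move=> nE; split=> [Ctx|Qtx]; apply: contrapT => nx; apply: nE; exists t => //.
  by left.
by right.
Qed.

(* Outer approximations of the set of points with a branch bounded by [u],
   by bar recursion.  The sets of points with a branch bounded by [u k] grow
   with [k], so taking the lower limit keeps the inclusion. *)
Inductive Hull J : nat -> set cantor -> Prop :=
| Hull_leaf u : lev c J u < cutoff c J -> Hull J u (Fin C u)
| Hull_node u X : cutoff c J <= lev c J u ->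
    (forall k, Hull J (sq (rcons (unsq u) k)) (X k)) ->
    Hull J u [set x | exists k, forall l, X (k + l) x].

(** Bar induction: a node without a hull lies in the tree and has a child without one, so a failure
    at the root would produce a branch of the cutoff tree. *)
Lemma Hull_exists J : exists X, Hull J 0 X.
Proof.
apply: contrapT => nH; have [_ + _] := cutoffP J; apply.
have nHu u : ~ (exists X, Hull J (sq u) X) -> cutoff c J <= lev c J (sq u).
  move=> nHu; rewrite leqNgt; apply/negP => lt_u; apply: nHu.
  by eexists; apply: Hull_leaf.
have [||f Hf] := @branchP (fun u => ~ exists X, Hull J (sq u) X).
- by rewrite sq_nil.
- move=> u nHX; apply: contrapT => nk; apply: (nHX); move/nHu: nHX => le_u.
  have /choice[X HX] k : exists X, Hull J (sq (rcons u k)) X.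
    by apply: contrapT => nX; apply: nk; exists k.
  by eexists; apply: (Hull_node le_u) => k; rewrite sqK; apply: HX.
- by exists f => n; apply: nHu; apply: Hf.
Qed.

Lemma caratheodory_Hull J u X : Hull J u X -> caratheodory X.
Proof.
elim=> {u X} [u _|u X _ _ mX]; first exact: caratheodory_Fin.
by apply: caratheodory_exists => k; apply: caratheodory_forall => l; apply: mX.
Qed.

Lemma Hull_branch J u X f x : Hull J u X ->
  bounded_by (fbar f (size (unsq u))) u -> (forall n, C (fbar f n) x) -> X x.
Proof.
move=> HX + Cx; elim: HX => {u X} [u _|u X _ _ IHX] bu.
  exists (fbar f (size (unsq u))); split=> // i.
  by rewrite sqK /mkseq -map_take take_iota; apply: Cx.
(* From this child on, the new last entry dominates the next value of [f], so all later children
   contain the point. *)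
exists (f (size (unsq u))) => l; apply: IHX.
rewrite sqK size_rcons /fbar mkseqS; apply: bounded_rcons; last exact: leq_addr.
by rewrite unsqK.
Qed.

(** The lower limit is an increasing union of intersections, each contained in a single child. The
    errors of the children are therefore never summed, and the bound is independent of the rank of
    the tree. *)
Lemma cmeasure_Hull J u X : Hull J u X ->
  bounded_by (leftmost c J (size (unsq u))) u ->
  (cmeasure ((X `\` Kinf J) `\` E J) <= ((2^-1 : R) ^+ J)%:E)%E.
Proof.
have mKE Y : caratheodory Y -> caratheodory ((Y `\` Kinf J) `\` E J).
  move=> mY; apply: caratheodory_measurable_setD (caratheodory_E J).
  apply: caratheodory_measurable_setD => //; apply: caratheodory_forall => n.
  by apply: caratheodory_cof; apply: clopen_comb.
elim=> {u X} [u lt_u|u X _ HX IHX] bu.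
  apply: le_trans (cmeasure_branch bu lt_u (lev_leftmost J)).
  apply: le_cmeasure => x [[[s [bs Cs]] nKx] nEx]; split=> //.
  rewrite cof_comb; exists s; split=> // i.
  by case: (outsideE (sq (take i (unsq s))) nEx) => CQ _; apply: CQ.
pose Y k := [set x | forall l, X (k + l) x] `\` Kinf J `\` E J.
apply: (@le_trans _ _ (cmeasure (\bigcup_k Y k))).
  by apply: le_cmeasure => x [[[k Xx] nKx] nEx]; exists k.
apply: caratheodory_nondecreasing_le => [k|k x|k].
- by apply: mKE; apply: caratheodory_forall => l; apply: caratheodory_Hull (HX _).
- by move=> [[Xx nKx] nEx]; split=> //; split=> // l; rewrite addSnnS; apply: Xx.
(* The next entry of the leftmost branch: a child with number at least [l] still dominates that
   branch. *)
pose l := g J (size (unsq u)).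
apply: le_trans (IHX (k + l) _); first by apply: le_cmeasure => x [[Xx nKx] nEx].
rewrite sqK size_rcons leftmostE /fbar mkseqS.
by apply: bounded_rcons; [rewrite unsqK -/(fbar _ _) -leftmostE|exact: leq_addl].
Qed.

Definition inner : set cantor :=
  [set x | exists J, forall n, Fin B (leftmost c J n) x].

Lemma inner_sub (P : nat -> set cantor) : (forall t, B t `<=` P t) -> inner `<=` Aop P.
Proof.
move=> BP x [J HJ]; have [n|f Hf] := @konig (fun t => B t x) (g J).
  by have [s [bs Bs]] := HJ n; exists s; rewrite -leftmostE.
by exists f => n; apply: BP.
Qed.

Lemma Hull_sub (P : nat -> set cantor) J X :
  (forall t, P t `<=` C t) -> Hull J 0 X -> Aop P `<=` X.
Proof.
move=> PC HX x [f Pf]; apply: (Hull_branch HX) => [|n]; last exact/PC/Pf.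
exact: bounded_fbar0.
Qed.

Lemma clopen_approx_A j : clopen_fun (approx_A c j).
Proof. exact: clopen_comb. Qed.

(** Off [E J], a point of [Kinf J] is in [inner], and it is in [K J u] anyway. What remains are
    three sets of measure at most [2 ^- (j + 2)]: [E J], the hull minus [Kinf J], and [K J u] minus
    [Kinf J]. *)
Lemma cmeasure_approx_A (X : nat -> set cantor) j :
  (forall J, Hull J 0 (X J)) ->
  (cmeasure (([set x | forall J, X J x] `\` cof (approx_A c j)) `|`
             (cof (approx_A c j) `\` inner)) <= ((2^-1 : R) ^+ j)%:E)%E.
Proof.
move=> HX; pose J := j.+2; pose u := leftmost c J (stage c J).
have sub : ([set x | forall J, X J x] `\` cof (approx_A c j)) `|`
    (cof (approx_A c j) `\` inner) `<=`
    E J `|` ((X J `\` Kinf J `\` E J) `|` (K J u `\` Kinf J)).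
  move=> x H; case: (pselect (E J x)) => [|nE]; [by left | right].
  case: H => -[Hx nx].
    by left; split=> //; split; [apply: Hx | move/(_ (stage c J)) => /nx].
  right; split=> // Kx; apply: nx; exists J => n.
  have [s [bs Qs]] : Fin (Q J) (leftmost c J n) x by rewrite -cof_comb; apply: Kx.
  exists s; split=> // i.
  by case: (outsideE (sq (take i (unsq s))) nE) => _; apply.
apply: le_trans (le_cmeasure sub) _; apply: le_trans (outer_measureU2 _ _ _) _.
have le3 : (cmeasure ((X J `\` Kinf J `\` E J) `|` (K J u `\` Kinf J)) <=
    ((2^-1 : R) ^+ J)%:E + ((2^-1 : R) ^+ J)%:E)%E.
  apply: le_trans (outer_measureU2 _ _ _) _; apply: leeD.
    apply: cmeasure_Hull (HX J) _; rewrite leftmostE.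
    exact: bounded_fbar0.
  apply: (@cmeasure_branch J u (lev c J u).+1) => [||n] //; last exact: stageP.
  have -> : size (unsq u) = stage c J by rewrite /u leftmostE sqK size_mkseq.
  by apply/boundedP; split.
apply: le_trans (leeD (cmeasure_E J) le3) _.
rewrite -!EFinD lee_fin /J !exprS.
have : (0 <= (2^-1 : R) ^+ j)%R by rewrite exprn_ge0 // invr_ge0.
by move: (_ ^+ j)%R => e e_ge0; lra.
Qed.

End Scheme.

(** * The automaton writing the Borel codes *)

Definition fld (i q : nat) : nat := nth 0 (unsq q) i.

Section Automaton.
(* Labels are those of Borel codes, with [0] for countable intersections. *)
Variables (lab : nat -> nat) (child : nat -> nat -> nat).

Inductive AutDen : nat -> set cantor -> Prop :=
| AutDen_leaf q k : lab q = k.+3 -> AutDen q (cyl (bits k))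
| AutDen_compl q A : lab q = 1 -> AutDen (child q 0) A -> AutDen q (~` A)
| AutDen_union q (A : nat -> set cantor) : lab q = 2 ->
    (forall n, AutDen (child q n) (A n)) -> AutDen q [set x | exists n, A n x]
| AutDen_inter q (A : nat -> set cantor) : lab q = 0 ->
    (forall n, AutDen (child q n) (A n)) -> AutDen q [set x | forall n, A n x].

(* An intersection is the complement of a union of complements: the
   intermediate nodes [sq [:: t; q]] carry a tag [t], which is [1] at the
   union and [2] at the inner complements. *)
Definition tag_lab (p : nat) : nat :=
  if fld 0 p == 0 then (if lab (fld 1 p) == 0 then 1 else lab (fld 1 p))
  else if fld 0 p == 1 then 2 else 1.

Definition tag_child (p n : nat) : nat :=
  if fld 0 p == 0 then
    (if lab (fld 1 p) == 0 then sq [:: 1; fld 1 p] else sq [:: 0; child (fld 1 p) n])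
  else if fld 0 p == 1 then sq [:: 2; child (fld 1 p) n] else sq [:: 0; fld 1 p].

(** The address [tau] is generalized to any one leading to [q]. An intersection occupies three Borel
    nodes, so its components sit two levels deeper than those of a union. *)
Lemma AutDen_Borel g p tau q A :
  (forall tau, g (sq tau) = tag_lab (foldl tag_child p tau)) ->
  foldl tag_child p tau = sq [:: 0; q] -> AutDen q A -> BorelDen g tau A.
Proof.
move=> gE + HA; elim: HA tau => {q A} [q k Dq|q A Dq _ IHA|q A Dq _ IHA|q A Dq _ IHA]
  tau Dtau.
- by apply: BD_leaf; rewrite gE Dtau /tag_lab /fld sqK /= Dq.
- apply: BD_compl; first by rewrite gE Dtau /tag_lab /fld sqK /= Dq.
  by apply: IHA; rewrite foldl_rcons Dtau /tag_child /fld sqK /= Dq.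
- apply: BD_union => [|n]; first by rewrite gE Dtau /tag_lab /fld sqK /= Dq.
  by apply: IHA; rewrite foldl_rcons Dtau /tag_child /fld sqK /= Dq.
- have D1 : foldl tag_child p (rcons tau 0) = sq [:: 1; q].
    by rewrite foldl_rcons Dtau /tag_child /fld sqK /= Dq.
  have D2 n : foldl tag_child p (rcons (rcons tau 0) n) = sq [:: 2; child q n].
    by rewrite foldl_rcons D1 /tag_child /fld sqK.
  rewrite (_ : [set x | _] = ~` [set x | exists n, (~` A n) x]); last first.
    apply/seteqP; split=> x /=; first by move=> Ax [n].
    by move=> nA n; apply: contrapT => nAn; apply: nA; exists n.
  apply: BD_compl; first by rewrite gE Dtau /tag_lab /fld sqK /= Dq.
  apply: BD_union => [|n]; first by rewrite gE D1 /tag_lab /fld sqK.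
  apply: BD_compl; first by rewrite gE D2 /tag_lab /fld sqK.
  by apply: IHA; rewrite foldl_rcons D2 /tag_child /fld sqK.
Qed.

Lemma caratheodory_AutDen q A : AutDen q A -> caratheodory A.
Proof.
elim=> {q A} [q k _|q A _ _ mA|q A _ _ mA|q A _ _ mA].
- rewrite -cof_cyl; apply: caratheodory_cof; exists (size (bits k)).
  exact: depends_cyl.
- exact: caratheodory_measurable_setC.
- exact: caratheodory_exists.
- exact: caratheodory_forall.
Qed.

Lemma AutDen_eq q A A' : AutDen q A -> A = A' -> AutDen q A'.
Proof. by move=> ? <-. Qed.

End Automaton.

(** A total version with a dummy value, so that the transitions can be written without a proof that
    the node belongs to a code. *)
Definition approx_of (f : nat -> nat) (sigma : seq nat) : nat -> nat -> bool :=
  if pselect (exists a, Approx f sigma a) is left ex then sval (cid ex)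
  else fun _ _ => false.

Lemma approx_ofE f sigma a : Approx f sigma a -> approx_of f sigma = a.
Proof.
move=> Ha; rewrite /approx_of; case: pselect => [ex|[]]; last by exists a.
by case: cid => b /= Hb; apply: Approx_inj Hb Ha.
Qed.

(** * States and transitions *)

Definition child_approx f (s n : nat) : nat -> nat -> bool :=
  approx_of f (rcons (unsq s) n).

(* The states [st kind pol s J u k]: [s] is a node of the Suslin code [f],
   and [pol] is [0] for inner and [1] for outer approximations.  By kinds:
   0 the approximation at [s];
   1 (pol = 0) the [J]-th set of the union [inner] at [s];
   2 (pol = 1) the hull of [u] of precision [J], as in [Hull];
   3 the intersection of the hulls of [u(k + l)], for all [l];
   4 the set [Fin] of [u];
   5 the intersection of the approximations at the prefixes of [u];
   6 a cylinder;
   7 the empty set. *)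
Definition st (kind pol s J u k : nat) : nat := sq [:: kind; pol; s; J; u; k].

Lemma fld_st i kind pol s J u k :
  fld i (st kind pol s J u k) = nth 0 [:: kind; pol; s; J; u; k] i.
Proof. by rewrite /fld sqK. Qed.

(** Kind 7 has the label of a complement, and its child is the cylinder of the empty sequence. *)
Definition empty_st : nat := st 7 0 0 0 0 0.

Definition node_st (pol : nat) (sigma : seq nat) : nat := st 0 pol (sq sigma) 0 0 0.

Definition st_lab (f : nat -> nat) (q : nat) : nat :=
  if fld 0 q == 0 then
    if f (fld 2 q) == 1 then 1
    else if f (fld 2 q) == 2 then (if fld 1 q == 0 then 2 else 0) else 2
  else if (fld 0 q == 1) || (fld 0 q == 3) || (fld 0 q == 5) then 0
  else if (fld 0 q == 2) || (fld 0 q == 4) then 2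
  else if fld 0 q == 6 then (fld 4 q).+3 else 1.

(* The part of the transition function which depends on the approximations. *)
Definition st_query (f : nat -> nat) (q n : nat) : nat :=
  if fld 0 q == 1 then leftmost (child_approx f (fld 2 q)) (fld 3 q) n
  else if fld 0 q == 2 then
    nat_of_bool (cutoff (child_approx f (fld 2 q)) (fld 3 q) <=
      lev (child_approx f (fld 2 q)) (fld 3 q) (fld 4 q))
  else 0.

Definition mem_code (k n : nat) : bool :=
  `[< exists i, (i < size (unsq k)) && (nth 0 (unsq k) i == n) >].

Definition st_next (f : nat -> nat) (q n a : nat) : nat :=
  if fld 0 q == 0 then
    if f (fld 2 q) == 1 then
      st 0 (1 - fld 1 q) (sq (rcons (unsq (fld 2 q)) 0)) 0 0 0
    else if f (fld 2 q) == 2 then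
      (if fld 1 q == 0 then st 1 0 (fld 2 q) n 0 0 else st 2 1 (fld 2 q) n 0 0)
    else if mem_code (f (fld 2 q) - 3) n then st 6 0 0 0 n 0 else empty_st
  else if fld 0 q == 1 then st 4 0 (fld 2 q) 0 a 0
  else if fld 0 q == 2 then
    (if a == 0 then st 4 1 (fld 2 q) 0 (fld 4 q) 0
     else st 3 1 (fld 2 q) (fld 3 q) (fld 4 q) n)
  else if fld 0 q == 3 then
    st 2 1 (fld 2 q) (fld 3 q) (sq (rcons (unsq (fld 4 q)) (fld 5 q + n))) 0
  else if fld 0 q == 4 then
    (if bounded_by n (fld 4 q) then st 5 (fld 1 q) (fld 2 q) 0 n 0 else empty_st)
  else if fld 0 q == 5 then
    st 0 (fld 1 q) (sq (rcons (unsq (fld 2 q)) (sq (take n (unsq (fld 4 q)))))) 0 0 0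
  else st 6 0 0 0 0 0.

Definition st_child f q n : nat := st_next f q n (st_query f q n).

(** The invariant under which a transition converges: kinds 1 to 5 sit at a node for the operation
    A, where the approximations of all children exist. *)
Definition valid_st (f : nat -> nat) (q : nat) : Prop :=
  (fld 0 q <= 5 -> exists a, Approx f (unsq (fld 2 q)) a) /\
  (0 < fld 0 q <= 5 -> f (fld 2 q) = 2).

Lemma Approx_child1 f sigma a : Approx f sigma a -> f (sq sigma) = 1 ->
  exists b, Approx f (rcons sigma 0) b.
Proof. by case=> {sigma a} [s k ->|s a _ Ha _|s c ->] //; exists a. Qed.

Lemma Approx_child2 f sigma a n : Approx f sigma a -> f (sq sigma) = 2 ->
  exists b, Approx f (rcons sigma n) b.
Proof. by case=> {sigma a} [s k ->|s a ->|s c _ Hc _] //; exists (c n). Qed.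

Lemma valid_child f q n : valid_st f q -> valid_st f (st_child f q n).
Proof.
rewrite /st_child /st_next; move: (st_query f q n) => a.
case=> ex lab2; move: ex lab2.
have [-> /(_ isT)[b Hb] _|nz] := eqVneq (fld 0 q) 0.
  rewrite /valid_st; have [D1|_] := eqVneq (f (fld 2 q)) 1.
    rewrite !fld_st; split=> //= _; rewrite sqK; apply: Approx_child1 Hb _.
    by rewrite unsqK.
  have [D2|_] := eqVneq (f (fld 2 q)) 2.
    by case: ifP => _; rewrite !fld_st; split=> //= _; exists b.
  by case: ifP => _; rewrite !fld_st.
rewrite lt0n nz /=.
have [le5|gt5] := leqP (fld 0 q) 5; last first.
  do 5 (case: eqP => [D|_]; first by rewrite D in gt5).
  by move=> _ _; rewrite /valid_st !fld_st.
move=> /(_ isT)[b Hb] /(_ isT) D2.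
have ok k pol J u l : 0 < k -> valid_st f (st k pol (fld 2 q) J u l).
  by move=> k_gt0; rewrite /valid_st !fld_st /= k_gt0; split=> // _; exists b.
have oke : valid_st f empty_st by rewrite /valid_st !fld_st.
case: ifP => _; first exact: ok.
case: ifP => _; first by case: ifP => _; apply: ok.
case: ifP => _; first exact: ok.
case: ifP => _; first by case: ifP => _; [apply: ok | apply: oke].
case: ifP => _; last by rewrite /valid_st !fld_st.
rewrite /valid_st !fld_st /=; split=> // _.
by rewrite sqK; apply: Approx_child2 Hb _; rewrite unsqK.
Qed.

(** * Computability of the automaton *)

Lemma foldl_iteri (T : Type) (h : T -> nat -> T) z (s : seq nat) :
  foldl h z s = iteri (size s) (fun i acc => h acc (nth 0 s i)) z.
Proof.
suff H i : i <= size s ->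
    foldl h z (take i s) = iteri i (fun i acc => h acc (nth 0 s i)) z.
  by rewrite -H // take_size.
elim: i => [|i IHi] lt_i; first by rewrite take0.
by rewrite (take_nth 0) // foldl_rcons IHi // ltnW.
Qed.

Ltac cmp_rule ::=
  lazymatch goal with
  | |- Cmp (fun w => addn (@?a w) (@?b w)) => apply: Cmp_addn
  | |- Cmp (fun w => subn (@?a w) (@?b w)) => apply: Cmp_subn
  | |- Cmp (fun w => nat_of_bool ((@?a w) && (@?b w))) => apply: Cmp_andb
  | |- Cmp (fun w => nat_of_bool ((@?a w) || (@?b w))) => apply: Cmp_orb
  | |- Cmp (fun w => nat_of_bool (leq (@?a w) (@?b w))) => apply: Cmp_leq
  | |- Cmp (fun w => nat_of_bool (@eq_op _ (@?a w) (@?b w))) => apply: Cmp_eqn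
  | |- Cmp (fun w => nat_of_bool (asbool (exists k, is_true (@?b w k)))) =>
      apply: (@Cmp_exists _ b); rewrite /Cmp1
  | |- Cmp (fun w => nat_of_bool (asbool (forall k, is_true (@?b w k)))) =>
      apply: (@Cmp_forall _ b); rewrite /Cmp1
  | |- Cmp (fun w => size (unsq (@?a w))) => apply: Cmp_size
  | |- Cmp (fun w => nth 0 (unsq (@?a w)) (@?b w)) => apply: Cmp_nth
  | |- Cmp (fun w => sq (rcons (unsq (@?a w)) (@?b w))) => apply: Cmp_rcons
  | |- Cmp (fun w => sq (take (@?b w) (unsq (@?a w)))) => apply: Cmp_take
  | |- Cmp (fun w => sq (cons (@?a w) (@?b w))) => apply: Cmp_sq_cons
  | |- Cmp (fun w => nat_of_bool (@?a w)) => fail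
  | |- _ => apply: Cmp_if
  end.

Lemma Cmp_st_lab (G : ctx) (q : G -> nat) :
  Cmp q -> Cmp (fun w => st_lab (ctx_fun w) (q w)).
Proof. by move=> Hq; rewrite /st_lab /fld; cmp. Qed.

Lemma Cmp_st_next (G : ctx) (q n a : G -> nat) :
  Cmp q -> Cmp n -> Cmp a ->
  Cmp (fun w => st_next (ctx_fun w) (q w) (n w) (a w)).
Proof.
move=> Hq Hn Ha.
have Hf : Cmp (fun w => ctx_fun w (nth 0 (unsq (q w)) 2)) by cmp.
rewrite /st_next /empty_st /st /fld /bounded_by /mem_code; cmp.
all: exact: (Cmp_weak Hf).
Qed.

(** One step of S5 running the automaton: previous state, counter and input word come in the order
    in which S5 supplies them. *)
Record step_world := StepWorld {
  sw_fun : nat -> nat; sw_state : nat; sw_index : nat; sw_input : nat;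
  sw_valid : valid_st sw_fun (fld 1 sw_state) }.

Definition step_ctx : ctx :=
  @Ctx step_world sw_fun (fun w => [:: sw_state w; sw_index w; sw_input w]).

Definition sw_letter (w : step_ctx) : nat := nth 0 (unsq (sw_input w)) (sw_index w).

Lemma Cmp_sw_state : Cmp (fun w : step_ctx => fld 1 (sw_state w)).
Proof.
have H : Cmp (fun w : step_ctx => sw_state w).
  by exists (sq [:: 3]) => w; apply: K3.
by rewrite /fld; cmp.
Qed.

Lemma Cmp_sw_letter : Cmp sw_letter.
Proof.
rewrite /sw_letter; apply: Cmp_nth.
  by eexists => w; do 2!apply: KComp_drop; apply: K3.
by eexists => w; apply: KComp_drop; apply: K3.
Qed.

Lemma Cmpc_child (D : step_ctx -> Prop) :
  (forall w, D w -> 0 < fld 0 (fld 1 (sw_state w)) <= 5) ->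
  Cmpc (G := sub_ctx D) (fun w =>
    child_approx (sw_fun (sval w)) (fld 2 (fld 1 (sw_state (sval w))))).
Proof.
move=> HD; have [e He] := Cmp_approx.
have Hq := @Cmp_sub _ _ D Cmp_sw_state.
apply: (@Cmpc_call (sub_ctx D)
  (fun w n => sq (rcons (unsq (fld 2 (fld 1 (sw_state (sval w))))) n)) (fun=> e)).
- apply: Cmp_rcons (Cmp_var0 _); apply: (@Cmp_weak (sub_ctx D)
    (fun w => fld 2 (fld 1 (sw_state (sval w))))).
  exact: Cmp_nth Hq (Cmp_const _ 2).
- exact: Cmp_const.
move=> [w Dw] n j y xs /=; have := HD _ Dw => kind_w.
have [ex lab2] := sw_valid w; have /andP[_ /ex[a Ha]] := kind_w.
have [|b Hb] := Approx_child2 n Ha _; first by rewrite unsqK lab2.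
by rewrite /child_approx (approx_ofE Hb); apply: He.
Qed.

Lemma Cmp_st_query :
  Cmp (fun w : step_ctx => st_query (sw_fun w) (fld 1 (sw_state w)) (sw_letter w)).
Proof.
pose q (w : step_ctx) := fld 1 (sw_state w).
have Hq : Cmp q := Cmp_sw_state; have Hn := Cmp_sw_letter.
pose chl (w : step_ctx) := child_approx (sw_fun w) (fld 2 (q w)).
have kindP k : Cmp (fun w => fld 0 (q w) == k) by rewrite /fld; cmp.
have Hc k : 0 < k <= 5 ->
    Cmpc (G := sub_ctx (fun w => fld 0 (q w) == k)) (fun w => chl (sval w)).
  by move=> le_k; apply: Cmpc_child => w /eqP->.
have fldS D i : Cmp (G := sub_ctx D) (fun w => fld i (q (sval w))).
  by apply: (@Cmp_sub _ (fun w => fld i (q w))); rewrite /fld; cmp.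
(* The approximations are queried under the guard on the kind; since at most one guard holds, the
   two results can be added. *)
have only k phi : Cmp (G := sub_ctx (fun w => fld 0 (q w) == k))
      (fun w => phi (sval w)) ->
    Cmp (fun w => if fld 0 (q w) == k then phi w else 0).
  move=> Hphi; apply: (Cmp_cond (kindP k)).
    by apply: eq_Cmp Hphi => -[w /= ->].
  by apply: (@eq_Cmp _ (fun=> 0)) (Cmp_const _ _) => -[w /= /negbTE->].
have H1 := only 1 (fun w => leftmost (chl w) (fld 3 (q w)) (sw_letter w))
  (Cmp_leftmost (Hc 1 isT) (fldS _ 3) (@Cmp_sub _ _ _ Hn)).
have H2 := only 2 (fun w => cutoff (chl w) (fld 3 (q w)) <=
    lev (chl w) (fld 3 (q w)) (fld 4 (q w)))
  (Cmp_leq (Cmp_cutoff (Hc 2 isT) (fldS _ 3))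
           (Cmp_lev (Hc 2 isT) (fldS _ 3) (fldS _ 4))).
apply: eq_Cmp (Cmp_addn H1 H2) => w; rewrite /st_query -/(q w) -/(chl w).
by case: eqP => [->|]; rewrite ?addn0 ?add0n.
Qed.

Lemma Cmp_tag_child : Cmp (fun w : step_ctx =>
  tag_child (st_lab (sw_fun w)) (st_child (sw_fun w)) (sw_state w) (sw_letter w)).
Proof.
have Hp : Cmp (fun w : step_ctx => sw_state w).
  by exists (sq [:: 3]) => w; apply: K3.
have Hq := Cmp_sw_state; have Hn := Cmp_sw_letter.
have Ht : Cmp (fun w : step_ctx => fld 0 (sw_state w)) by rewrite /fld; cmp.
have Hl := @Cmp_st_lab step_ctx _ Hq.
have Hc := @Cmp_st_next step_ctx _ _ _ Hq Hn Cmp_st_query.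
rewrite /tag_child /st_child.
apply: Cmp_if; first by cmp.
  apply: Cmp_if; first by apply: Cmp_eqn; [exact: Hl | exact: Cmp_const].
    by cmp.
  apply: Cmp_sq_cons; first exact: Cmp_const.
  by apply: Cmp_sq_cons; [exact: Hc | exact: Cmp_const].
apply: Cmp_if; first by cmp.
  apply: Cmp_sq_cons; first exact: Cmp_const.
  by apply: Cmp_sq_cons; [exact: Hc | exact: Cmp_const].
by cmp.
Qed.

Definition code_of (f : nat -> nat) (q n : nat) : nat :=
  tag_lab (st_lab f)
    (foldl (tag_child (st_lab f) (st_child f)) (sq [:: 0; q]) (unsq n)).

(** The initial state is built into the index and [f] stays an argument; thus the inner and the
    outer codes have one index each. *)
Lemma KComp_code_of q : exists e, forall f, valid_st f q ->
  forall n, KComp SuslinF e [:: f] [:: n] (code_of f q n).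
Proof.
have [es Hs] := Cmp_tag_child.
pose G := @Ctx ((nat -> nat) * nat)%type fst (fun w => [:: w.2]).
have Hin : Cmp (fun w : G => w.2) by exists (sq [:: 3]) => w; apply: K3.
have [ez Hz] := Cmp_size Hin.
have [el Hl] : Cmp (G := ext G) (fun w => tag_lab (st_lab w.1.1) w.2).
  rewrite /tag_lab; have Hp := Cmp_var0 G.
  have Hq : Cmp (G := ext G) (fun w => fld 1 w.2) by rewrite /fld; cmp.
  have Hlab := @Cmp_st_lab (ext G) _ Hq.
  apply: Cmp_if; first by rewrite /fld; cmp.
    by apply: Cmp_if; [apply: Cmp_eqn; [exact: Hlab|exact: Cmp_const]
      | exact: Cmp_const | exact: Hlab].
  by rewrite /fld; cmp.
exists (sq [:: 4; el; sq [:: 4; sq [:: 5; sq [:: 2; sq [:: 0; q]]; es]; ez]]).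
move=> f valid_q n; set p0 := sq [:: 0; q].
pose p i := iteri i (fun i acc =>
  tag_child (st_lab f) (st_child f) acc (nth 0 (unsq n) i)) p0.
have valid_p i : valid_st f (fld 1 (p i)).
  elim: i => [|i IHi]; first by rewrite /fld /p /= sqK.
  rewrite [p _]/= -/(p i) /tag_child.
  case: ifP => _; first by case: ifP => _; rewrite [fld 1 (sq _)]/fld sqK //=;
    exact: valid_child.
  by case: ifP => _; rewrite [fld 1 (sq _)]/fld sqK //=; exact: valid_child.
rewrite /code_of foldl_iteri -/(p _).
apply: K4 (K4 (Hz (f, n)) _) (Hl ((f, n), p (size (unsq n)))) => /=.
elim: (size (unsq n)) => [|i IHi]; first by apply: K5a; apply: K2.
by apply: K5b IHi _; exact: (Hs (@StepWorld f (p i) i n (valid_p i))).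
Qed.

(** * Correctness of the automaton *)

Section Semantics.
Variable f : nat -> nat.

Local Notation Den := (AutDen (st_lab f) (st_child f)).

Lemma Den_full : Den (st 6 0 0 0 0 0) setT.
Proof.
rewrite (_ : setT = cyl (bits 0)).
  by apply: AutDen_leaf; rewrite /st_lab !fld_st.
by apply/seteqP; split=> // x _ i; rewrite /bits -sq_nil sqK.
Qed.

Lemma Den_empty : Den empty_st set0.
Proof.
rewrite -setCT; apply: AutDen_compl; first by rewrite /st_lab !fld_st.
by rewrite /st_child /st_next !fld_st; apply: Den_full.
Qed.

Lemma Den_Fin pol sigma (S : nat -> set cantor) u :
  (forall t, Den (node_st pol (rcons sigma t)) (S t)) ->
  Den (st 4 pol (sq sigma) 0 u 0) (Fin S u).
Proof.
move=> HS; pose A n := if bounded_by n u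
  then [set x | forall i, S (sq (take i (unsq n))) x] else set0.
apply: (AutDen_eq (A := [set x | exists n, A n x])); last first.
  apply/seteqP; split=> x [n].
    by rewrite /A; case: ifP => // bn Ax; exists n.
  by case=> bn Sx; exists n; rewrite /A bn.
apply: AutDen_union => [|n]; first by rewrite /st_lab !fld_st.
rewrite /st_child /st_next !fld_st /= /A; case: ifP => _; last exact: Den_empty.
apply: AutDen_inter => [|i]; first by rewrite /st_lab !fld_st.
by rewrite /st_child /st_next !fld_st /= sqK; apply: HS.
Qed.

Lemma Den_Hull sigma (C : nat -> set cantor) J u X :
  (forall t, Den (node_st 1 (rcons sigma t)) (C t)) ->
  Hull (child_approx f (sq sigma)) C J u X -> Den (st 2 1 (sq sigma) J u 0) X.
Proof.
move=> HC; elim=> {u X} [u lt_u|u X le_u _ IHX].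
  (* The label of kind 2 is fixed without querying the level, so a leaf of the hull becomes a union
     of equal sets. *)
  apply: (AutDen_eq (A := [set x | exists _ : nat, Fin C u x])); last first.
    by apply/seteqP; split=> x; [case | exists 0].
  apply: AutDen_union => [|n]; first by rewrite /st_lab !fld_st.
  rewrite /st_child /st_next /st_query !fld_st /= leqNgt lt_u.
  exact: Den_Fin.
apply: AutDen_union => [|k]; first by rewrite /st_lab !fld_st.
rewrite /st_child /st_next /st_query !fld_st /= le_u.
apply: AutDen_inter => [|l]; first by rewrite /st_lab !fld_st.
by rewrite /st_child /st_next !fld_st /=; apply: IHX.
Qed.

Lemma Den_inner sigma (B : nat -> set cantor) : f (sq sigma) = 2 ->
  (forall t, Den (node_st 0 (rcons sigma t)) (B t)) ->
  Den (node_st 0 sigma) (inner (child_approx f (sq sigma)) B).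
Proof.
move=> D2 HB; apply: AutDen_union => [|J]; first by rewrite /st_lab !fld_st /= D2.
rewrite /st_child /st_next !fld_st /= D2 /=.
apply: AutDen_inter => [|n]; first by rewrite /st_lab !fld_st.
by rewrite /st_child /st_next /st_query !fld_st /=; apply: Den_Fin.
Qed.

Lemma Den_leaf pol sigma k : f (sq sigma) = k.+3 ->
  Den (node_st pol sigma) (clopen_of k).
Proof.
move=> Dk; pose A n := if mem_code k n then cyl (bits n) else set0.
have memE n : mem_code k n = (n \in unsq k).
  apply/asboolP/(nthP 0) => [[i /andP[lt_i /eqP <-]]|[i lt_i <-]]; exists i => //.
  by rewrite lt_i eqxx.
apply: (AutDen_eq (A := [set x | exists n, A n x])); last first.
  apply/seteqP; split=> x [n]; first by rewrite /A memE; case: ifP => // kn; exists n.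
  by move=> kn xn; exists n; rewrite /A memE kn.
apply: AutDen_union => [|n]; first by rewrite /st_lab !fld_st /= Dk.
rewrite /st_child /st_next !fld_st /= Dk !subSS subn0 /= /A.
case: ifP => _; last exact: Den_empty.
by apply: AutDen_leaf; rewrite /st_lab !fld_st.
Qed.

End Semantics.

(** * Induction over Suslin codes *)

Lemma leaf_approx_depends k : exists N, depends (leaf_approx k) N /\
  forall i, i < size (unsq k) -> size (unsq (nth 0 (unsq k) i)) <= N.
Proof.
pose N := (\max_(i < size (unsq k)) size (unsq (nth 0 (unsq k) i)))%N.
have HN i : i < size (unsq k) -> size (unsq (nth 0 (unsq k) i)) <= N.
  by move=> lt_i; exact: (leq_bigmax (Ordinal lt_i)).
exists N; split=> //; apply/dependsP => y; apply: asbool_equiv_eq.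
have bit l i : i < size (unsq k) -> l < size (unsq (nth 0 (unsq k) i)) ->
    (y %% 2 ^ N %/ 2 ^ l) %% 2 = (y %/ 2 ^ l) %% 2.
  move=> /HN le_N lt_l; have lt_N := leq_trans lt_l le_N.
  by rewrite modn_divl -expnS modn_dvdm ?dvdn_exp2l // expnS -modn_divl.
by split=> -[i /andP[lt_i /asboolP H]]; exists i; rewrite lt_i; apply/asboolP => l;
  have := H l; case: leqP => //= lt_l; rewrite (bit l i).
Qed.

Lemma cof_leaf k : cof (leaf_approx k) = clopen_of k.
Proof.
have [N [DN HN]] := leaf_approx_depends k.
have bitsE c i : nth false (bits c) i = (nth 0 (unsq c) i != 0).
  rewrite /bits; case: (ltnP i (size (unsq c))) => [lt_i|le_i].
    by rewrite (nth_map 0).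
  by rewrite !nth_default ?size_map.
apply/seteqP; split=> x; rewrite (cofE _ DN).
  move=> /asboolP[i /andP[lt_i /asboolP H]].
  exists (nth 0 (unsq k) i); first exact: mem_nth.
  move=> l; rewrite bitsE size_map => lt_l; have := H l.
  rewrite leqNgt lt_l /= prefix_num_bit; last exact: leq_trans lt_l (HN _ lt_i).
  by case: (x l); case: (_ != 0).
move=> [c /(nthP 0)[i lt_i <-] cx]; apply/asboolP; exists i; rewrite lt_i.
apply/asboolP => l; case: leqP => //= lt_l.
rewrite prefix_num_bit; last exact: leq_trans lt_l (HN _ lt_i).
by rewrite cx ?size_map // bitsE.
Qed.

(** The error estimate is part of the induction since a node for A needs it at all its children. At
    a complement the two halves of the error set trade places. *)
Lemma approximation f sigma P : SuslinDen f sigma P -> exists B C : set cantor,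
  [/\ AutDen (st_lab f) (st_child f) (node_st 0 sigma) B,
      AutDen (st_lab f) (st_child f) (node_st 1 sigma) C,
      B `<=` P, P `<=` C &
      forall j, clopen_fun (approx_of f sigma j) /\
        (cmeasure ((C `\` cof (approx_of f sigma j)) `|`
                   (cof (approx_of f sigma j) `\` B)) <= ((2^-1 : R) ^+ j)%:E)%E].
Proof.
have e_ge0 j : (0 <= (2^-1 : R) ^+ j)%R by rewrite exprn_ge0 // invr_ge0.
elim=> {sigma P} [sigma k Dk|sigma P D1 HP [B [C [HB HC BP PC HE]]]|sigma P D2 HP IHP].
- exists (clopen_of k), (clopen_of k); split=> // [||j]; try exact: Den_leaf.
  rewrite (approx_ofE (Approx_leaf Dk)) cof_leaf setDv setU0 cmeasure0 lee_fin.
  by split=> //; have [N []] := leaf_approx_depends k; exists N.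
- have [a Ha] := SuslinDen_Approx HP.
  have HE' j := HE j; rewrite (approx_ofE Ha) in HE'.
  exists (~` C), (~` B); split.
  + apply: AutDen_compl; first by rewrite /st_lab !fld_st /= D1.
    by rewrite /st_child /st_next !fld_st /= D1 /= sqK.
  + apply: AutDen_compl; first by rewrite /st_lab !fld_st /= D1.
    by rewrite /st_child /st_next !fld_st /= D1 /= sqK.
  + exact: subsetC.
  + exact: subsetC.
  move=> j; have [clj le_j] := HE' j; rewrite (approx_ofE (Approx_compl D1 Ha)).
  rewrite cof_setC //; split.
    by case: clj => N DN; exists N; apply: depends_neg.
  apply: le_trans le_j; apply: le_cmeasure => x [[nB nC]|[nC nB]].
    by right; split=> //; apply: contrapT.
  by left; split=> //; apply: contrapT.
have /choice[a Ha] t : exists a, Approx f (rcons sigma t) a.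
  exact: SuslinDen_Approx (HP t).
have Dc : child_approx f (sq sigma) = a.
  by apply: funext => t; rewrite /child_approx sqK (approx_ofE (Ha t)).
have /choice[B IHB] := IHP; have /choice[C IH] := IHB.
have cl_a t j : clopen_fun (a t j).
  by have [_ _ _ _ /(_ j)[]] := IH t; rewrite (approx_ofE (Ha t)).
have err_a t j : (cmeasure ((C t `\` cof (a t j)) `|` (cof (a t j) `\` B t)) <=
    ((2^-1 : R) ^+ j)%:E)%E.
  by have [_ _ _ _ /(_ j)[_]] := IH t; rewrite (approx_ofE (Ha t)).
have mB t : caratheodory (B t).
  by have [HB _ _ _ _] := IH t; apply: caratheodory_AutDen HB.
have mC t : caratheodory (C t).
  by have [_ HC _ _ _] := IH t; apply: caratheodory_AutDen HC.
have /choice[X HX] J : exists X, Hull a C J 0 X by apply: Hull_exists.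
exists (inner a B), [set x | forall J, X J x]; split.
- by rewrite -Dc; apply: Den_inner => // t; have [] := IH t.
- apply: AutDen_inter => [|J]; first by rewrite /st_lab !fld_st /= D2.
  rewrite /st_child /st_next !fld_st /= D2 /=.
  by apply: (Den_Hull (C := C)) => [t|]; [have [] := IH t | rewrite Dc].
- by apply: inner_sub => // t; have [] := IH t.
- by move=> x Px J; apply: Hull_sub (HX J) _ Px => t; have [] := IH t.
- move=> j; rewrite (approx_ofE (Approx_A D2 Ha)); split.
    by apply: clopen_approx_A.
  exact: (cmeasure_approx_A cl_a mB mC err_a j HX).
Qed.

Lemma code_of_Borel f q A :
  AutDen (st_lab f) (st_child f) q A -> BorelDen (code_of f q) [::] A.
Proof.
apply: (AutDen_Borel (p := sq [:: 0; q])) => // tau.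
by rewrite /code_of sqK.
Qed.

Theorem theorem2p9 :
  exists e1 e2 : nat,
  forall (f : nat -> nat) (P : set cantor),
    SuslinDen f [::] P ->
    exists (g h : nat -> nat) (B C : set cantor),
      (forall n, KComp SuslinF e1 [:: f] [:: n] (g n)) /\
      (forall n, KComp SuslinF e2 [:: f] [:: n] (h n)) /\
      BorelDen g [::] B /\ BorelDen h [::] C /\
      B `<=` P /\ P `<=` C /\ cmeasure B = cmeasure C.
Proof.
have [e1 He1] := KComp_code_of (node_st 0 [::]).
have [e2 He2] := KComp_code_of (node_st 1 [::]).
exists e1, e2 => f P HP.
have valid pol : valid_st f (node_st pol [::]).
  have [a Ha] := SuslinDen_Approx HP.
  by rewrite /valid_st !fld_st; split=> //= _; exists a; rewrite sqK.
have [B [C [HB HC BP PC HE]]] := approximation HP.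
exists (code_of f (node_st 0 [::])), (code_of f (node_st 1 [::])), B, C.
do 2!(split; first by move=> n; auto).
do 2!(split; first exact: code_of_Borel).
split=> //; split=> //; apply/eqP; rewrite eq_le le_cmeasure /=; last exact: subset_trans PC.
apply: le_trans (cmeasureD C B) _.
suff -> : cmeasure (C `\` B) = 0%E by rewrite adde0.
apply/eqP; rewrite eq_le cmeasure_ge0 andbT.
(* Every cylinder contains [set0], so [weight set0] is the infimum of all [2 ^- size s], and it
   suffices to bound the measure by each of these. *)
apply: le_trans (_ : (weight set0 <= 0)%E); last by rewrite weight0.
apply: le_ereal_inf_tmp => _ [s _ <-]; have [_] := HE (size s).
apply: le_trans; apply: le_cmeasure => x [Cx nBx].
by case: (pselect (cof (approx_of f [::] (size s)) x)); [right | left].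
Qed.
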